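(* Let $f:\mathcal{X}\times\mathcal{Y}\to\{0,1\}$. Suppose there is a protocol $\pi$ for $f$ in the specialized product-distributional communication model with $\delta$ soundness, false positive (type I) error $\epsilon$ under Merlin's unique special message, cost $(c_a,c_b,c_c,c_m)$ and time $(t_a,t_b,t_c)$. Then there exists a data structure supporting: (1) Preprocess: given $\mathcal{D}=\{x^{(1)},\dots,x^{(n)}\}\subseteq\mathcal{X}$, preprocess $\mathcal{D}$ using space $s=2^{O(c_a+c_b+c_m)}\cdot(n+c_c)$ and time $t_p=2^{O(c_a+c_b+c_m)}\cdot n\cdot(t_a+t_b+t_c)$. (2) Query: given $y\in\mathcal{Y}$, output all $x^{(i)}\in\mathcal{D}$ with $f(x^{(i)},y)=1$, in expected time $t_q=2^{O(c_a+c_m)}\cdot(c_a+c_b+c_m+c_c+t_b)+O(\epsilon n)+2^{O(c_m)}\cdot\delta n+O(n_y)$, where $n_y$ is the number of $x^{(i)}\in\mathcal{D}$ with $f(x^{(i)},y)=1$.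
   Context: Specialized product-distributional communication model for $f:\mathcal{X}\times\mathcal{Y}\to\{0,1\}$: four parties Alice, Bob, Carol, Merlin. Let $\lambda$ be an arbitrary distribution on $\mathcal{X}$ and $y\in\mathcal{Y}$ arbitrary (worst case). Alice knows $\lambda$ and her input $x\sim\lambda$; Bob knows only $y$; Carol knows only $\lambda$; Merlin knows $\lambda$, $x$ and $y$. Carol is the only party using randomness: public randomness $R_{\mathrm{pub}}$ (visible to Merlin) and private randomness $R_{\mathrm{pri}}$ (hidden from Merlin); Carol writes messages to a public channel seen by Alice and Bob, and Carol and Merlin see all messages between Alice and Bob. Merlin sends advice $m$ to Alice and Bob. The output is denoted $\pi(\lambda,x,y,m,R_{\mathrm{pub}},R_{\mathrm{pri}})$. For every $\lambda,x,y,R_{\mathrm{pub}}$ there is a unique special advice $m^*(\lambda,x,y,R_{\mathrm{pub}})$. The protocol has $\epsilon$ error and $\delta$ soundness if for all $\lambda$ and all $y$: (i) $\Pr_{x\sim\lambda,R_{\mathrm{pub}},R_{\mathrm{pri}}}[\pi(\lambda,x,y,m^*(\lambda,x,y,R_{\mathrm{pub}}),R_{\mathrm{pub}},R_{\mathrm{pri}})\neq f(x,y)]\leq\epsilon$; (ii) for every $x$ in the support of $\lambda$, every $R_{\mathrm{pub}}$ and every $m\neq m^*(\lambda,x,y,R_{\mathrm{pub}})$, $\Pr_{R_{\mathrm{pri}}}[\pi(\lambda,x,y,m,R_{\mathrm{pub}},R_{\mathrm{pri}})\neq 0]\leq\delta$. The error is false positive (type I) if under the special advice the protocol can be wrong only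 when $f(x,y)=0$. Cost $(c_a,c_b,c_c,c_m)$: total bits sent by Alice to Bob, Bob to Alice, Carol to Alice and Bob, and Merlin to Alice and Bob. Time $(t_a,t_b,t_c)$: time Alice, Bob and Carol use to construct all their messages. Space is measured in bits (word-RAM).
   Formalization: The query may evaluate f(x^(i),y) on a stored element in one time step; without this the claim fails, e.g. for the protocol that always accepts with ε = 1 and no communication, where f would have to be decided in O(1) time. D is nonempty and is read by index. *)

(* Defs.v *)
From HB Require Import structures.
From mathcomp Require Import all_boot all_order all_algebra finmap.

Set Implicit Arguments.
Unset Strict Implicit.
Unset Printing Implicit Defensive.

Import Order.TTheory GRing.Theory Num.Theory.

Local Open Scope nat_scope.

Section Distributions.
Local Open Scope ring_scope.
Variables (R : realFieldType) (T : choiceType).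

Record dist := Dist {
  pmf :> {fsfun T -> R with 0};
  _ : [forall x : finsupp pmf, 0 <= pmf (val x)]
      && (\sum_(x <- finsupp pmf) pmf x == 1)
}.

Definition expect (P : dist) (F : T -> R) : R :=
  \sum_(x <- finsupp P) P x * F x.

Definition prob (P : dist) (E : pred T) : R := \sum_(x <- finsupp P | E x) P x.

Definition uniform_fun (D : seq T) : {fsfun T -> R with 0} :=
  [fsfun x in [fset x in D]%fset => (size D)%:R^-1 | 0].

Lemma uniform_fun_dist (D : seq T) : uniq D -> (0 < size D)%N ->
  [forall x : finsupp (uniform_fun D), 0 <= uniform_fun D (val x)]
  && (\sum_(x <- finsupp (uniform_fun D)) uniform_fun D x == 1).
Proof.
move=> uD D_gt0; have D_neq0 : (size D)%:R != 0 :> R by rewrite pnatr_eq0 -lt0n.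
have valE x : uniform_fun D x = if x \in D then (size D)%:R^-1 else 0.
  by rewrite fsfunE in_fset.
apply/andP; split.
  by apply/forallP => x; rewrite valE; case: ifP => // _; rewrite invr_ge0 ler0n.
have suppD : perm_eq (finsupp (uniform_fun D)) D.
  apply: uniq_perm => // x.
  by rewrite mem_finsupp valE; case: ifP; rewrite ?invr_eq0 ?D_neq0 ?eqxx.
rewrite (perm_big _ suppD) /= (eq_big_seq (fun=> (size D)%:R^-1)) => [|x xD].
  by rewrite big_const_seq count_predT iter_addr_0 -[_^-1 *+ _]mulr_natl mulfV.
by rewrite valE xD.
Qed.

Definition uniform (D : seq T) (uD : uniq D) (D_gt0 : (0 < size D)%N) : dist :=
  Dist (uniform_fun_dist uD D_gt0).

End Distributions.

Variant party := Alice | Bob | Carol.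

Definition eq_party (p q : party) : bool :=
  match p, q with
  | Alice, Alice | Bob, Bob | Carol, Carol => true
  | _, _ => false
  end.

Definition advice (cm : nat) := cm.-tuple bool.

(* A protocol tree.  A node is the public transcript so far; its owner sends
   one bit, which selects the subtree.  The types of the message functions are
   what each party knows besides the transcript: Alice knows lambda, x and
   Merlin's advice, Bob knows y and the advice, Carol knows lambda and her two
   random strings but not the advice.  At a leaf Bob outputs.  The [nat]-valued
   functions give the number of steps spent computing the bit. *)
Section Trees.
Variables (R : realFieldType) (X : choiceType) (Y : Type).
Variables (Rpub Rpri : choiceType) (cm : nat).

Inductive ptree :=
| Output (out : Y -> advice cm -> bool) (steps : Y -> advice cm -> nat)
| ASend (msg : dist R X -> X -> advice cm -> bool)
        (steps : dist R X -> X -> advice cm -> nat) (t0 t1 : ptree)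
| BSend (msg : Y -> advice cm -> bool)
        (steps : Y -> advice cm -> nat) (t0 t1 : ptree)
| CSend (msg : dist R X -> Rpub -> Rpri -> bool)
        (steps : dist R X -> Rpub -> Rpri -> nat) (t0 t1 : ptree).

Fixpoint run (lam : dist R X) (x : X) (y : Y) (m : advice cm)
    (rpub : Rpub) (rpri : Rpri) (t : ptree) : bool :=
  match t with
  | Output out _ => out y m
  | ASend msg _ t0 t1 =>
      if msg lam x m then run lam x y m rpub rpri t1
      else run lam x y m rpub rpri t0
  | BSend msg _ t0 t1 =>
      if msg y m then run lam x y m rpub rpri t1
      else run lam x y m rpub rpri t0
  | CSend msg _ t0 t1 =>
      if msg lam rpub rpri then run lam x y m rpub rpri t1
      else run lam x y m rpub rpri t0
  end.

Fixpoint bits_sent (p : party) (t : ptree) : nat :=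
  match t with
  | Output _ _ => 0
  | ASend _ _ t0 t1 =>
      eq_party p Alice + maxn (bits_sent p t0) (bits_sent p t1)
  | BSend _ _ t0 t1 =>
      eq_party p Bob + maxn (bits_sent p t0) (bits_sent p t1)
  | CSend _ _ t0 t1 =>
      eq_party p Carol + maxn (bits_sent p t0) (bits_sent p t1)
  end.

(* The time of a party is its total time along a run, in the worst case over
   the bits of the other two parties.  A bit that takes [k] steps to compute
   counts [k.+1], one step being needed to write it. *)
Fixpoint alice_time (lam : dist R X) (x : X) (m : advice cm) (t : ptree) : nat :=
  match t with
  | Output _ _ => 0
  | ASend msg steps t0 t1 =>
      (steps lam x m).+1 + (if msg lam x m then alice_time lam x m t1
                            else alice_time lam x m t0)
  | BSend _ _ t0 t1 | CSend _ _ t0 t1 =>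
      maxn (alice_time lam x m t0) (alice_time lam x m t1)
  end.

Fixpoint bob_time (y : Y) (m : advice cm) (t : ptree) : nat :=
  match t with
  | Output _ steps => (steps y m).+1
  | BSend msg steps t0 t1 =>
      (steps y m).+1 + (if msg y m then bob_time y m t1 else bob_time y m t0)
  | ASend _ _ t0 t1 | CSend _ _ t0 t1 =>
      maxn (bob_time y m t0) (bob_time y m t1)
  end.

Fixpoint carol_time (lam : dist R X) (rpub : Rpub) (rpri : Rpri) (t : ptree) :
    nat :=
  match t with
  | Output _ _ => 0
  | CSend msg steps t0 t1 =>
      (steps lam rpub rpri).+1 +
      (if msg lam rpub rpri then carol_time lam rpub rpri t1
       else carol_time lam rpub rpri t0)
  | ASend _ _ t0 t1 | BSend _ _ t0 t1 =>
      maxn (carol_time lam rpub rpri t0) (carol_time lam rpub rpri t1)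
  end.

End Trees.

Record protocol (R : realFieldType) (X : choiceType) (Y : Type) := Protocol {
  Rpub : choiceType;
  Rpri : choiceType;
  Ppub : dist R Rpub;
  Ppri : dist R Rpri;
  advice_len : nat;
  tree : ptree R X Y Rpub Rpri advice_len;
  special : dist R X -> X -> Y -> Rpub -> advice advice_len
}.

Arguments special {R X Y} p lam x y rpub : rename.

Section Model.
Local Open Scope ring_scope.
Variables (R : realFieldType) (X : choiceType) (Y : Type).
Implicit Types (f : X -> Y -> bool) (pi : protocol R X Y).

Definition output pi (lam : dist R X) (x : X) (y : Y)
    (m : advice (advice_len pi)) (rpub : Rpub pi) (rpri : Rpri pi) : bool :=
  run lam x y m rpub rpri (tree pi).

Arguments output : clear implicits.

Definition has_error f pi (eps : R) :=
  forall (lam : dist R X) (y : Y),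
    expect lam (fun x => expect (Ppub pi) (fun rpub =>
      prob (Ppri pi) (fun rpri =>
        output pi lam x y (special pi lam x y rpub) rpub rpri != f x y))) <= eps.

Definition has_soundness pi (delta : R) :=
  forall (lam : dist R X) (y : Y) (x : X) (rpub : Rpub pi)
         (m : advice (advice_len pi)),
    x \in finsupp lam -> m != special pi lam x y rpub ->
    prob (Ppri pi) (fun rpri => output pi lam x y m rpub rpri != false) <= delta.

Definition false_positive_error f pi :=
  forall (lam : dist R X) (y : Y) (x : X) (rpub : Rpub pi) (rpri : Rpri pi),
    x \in finsupp lam ->
    output pi lam x y (special pi lam x y rpub) rpub rpri != f x y ->
    f x y = false.

Definition has_cost pi (ca cb cc cm : nat) :=
  [/\ (bits_sent Alice (tree pi) <= ca)%N, (bits_sent Bob (tree pi) <= cb)%N,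
      (bits_sent Carol (tree pi) <= cc)%N & advice_len pi = cm].

Definition has_time pi (ta tb tc : nat) :=
  [/\ forall (lam : dist R X) (x : X) (m : advice (advice_len pi)),
        x \in finsupp lam -> (alice_time lam x m (tree pi) <= ta)%N,
      forall (y : Y) (m : advice (advice_len pi)),
        (bob_time y m (tree pi) <= tb)%N
    & forall (lam : dist R X) (rpub : Rpub pi) (rpri : Rpri pi),
        (carol_time lam rpub rpri (tree pi) <= tc)%N].

End Model.

(* Word-RAM programs; registers are referred to by number.  Programs do not
   depend on the protocol or the data set: elements of X are accessed by their
   index in the data set, the query only through Bob and f. *)

Variant binop :=
  Add | Sub | Mul | Div | Mod | Shl | Shr | And | Or | Xor | Eqb | Ltb.

Variant instr :=
| Const (r k : nat)
| Op (o : binop) (r a b : nat)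
| Msb (r a : nat)            (* position of the most significant bit *)
| Read (r a k : nat)         (* r := field of k bits at bit address a *)
| Write (a k b : nat)        (* field of k bits at bit address a := b *)
| Start (m : nat)            (* simulate a new run of pi, with advice m *)
| Turn (r : nat)             (* r := who moves next in the simulated run *)
| Move (b : nat)             (* continue the simulated run with the bit b *)
| AskAlice (r i : nat)       (* r := Alice's next bit on the i-th element *)
| AskBob (r : nat)           (* r := Bob's next bit, or his output *)
| AskCarol (r : nat)
| Test (r i : nat)           (* r := value of f at the i-th element and the query *)
| Report (i : nat).          (* output the i-th element *)

Inductive prog :=
| Skip
| Do (i : instr)
| Seq (p q : prog)
| If (r : nat) (p q : prog)
| While (r : nat) (p : prog).

Definition eval_binop (w : nat) (o : binop) (a b : nat) : nat :=
  (match o with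
   | Add => a + b
   | Sub => a + 2 ^ w - b
   | Mul => a * b
   | Div => a %/ b
   | Mod => a %% b
   | Shl => a * 2 ^ b
   | Shr => a %/ 2 ^ b
   | And => Nat.land a b
   | Or => Nat.lor a b
   | Xor => Nat.lxor a b
   | Eqb => a == b
   | Ltb => a < b
   end) %% 2 ^ w.

Section Machine.
Variables (R : realFieldType) (X : choiceType) (Y : Type).
Variables (f : X -> Y -> bool) (pi : protocol R X Y).
(* data set, distribution handed to Alice and Carol, word length and memory
   size, both in bits *)
Variables (D : seq X) (lam : dist R X) (w space : nat).

(* Carol's random strings are only available during preprocessing, the query
   only afterwards. *)
Variant phase := Preprocess of Rpub pi & Rpri pi | Query of Y.

Record state := State {
  reg : nat -> nat;
  memory : nat -> bool;
  sim_adv : advice (advice_len pi);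
  sim_node : ptree R X Y (Rpub pi) (Rpri pi) (advice_len pi);
  reported : seq X
}.

Definition upd (g : nat -> nat) (r v : nat) : nat -> nat :=
  fun j => if j == r then v else g j.

Definition set_reg (s : state) (r v : nat) : state :=
  State (upd (reg s) r v) (memory s) (sim_adv s) (sim_node s) (reported s).

Definition load_field (g : nat -> bool) (a k : nat) : nat :=
  \sum_(j < k) g (a + j) * 2 ^ j.

Definition store_field (g : nat -> bool) (a k v : nat) : nat -> bool :=
  fun j => if a <= j < a + k then odd (v %/ 2 ^ (j - a)) else g j.

Definition advice_of_word (v : nat) : advice (advice_len pi) :=
  [tuple odd (v %/ 2 ^ i) | i < advice_len pi].

Definition turn_code (t : ptree R X Y (Rpub pi) (Rpri pi) (advice_len pi)) : nat :=
  match t with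
  | Output _ _ => 0
  | ASend _ _ _ _ => 1
  | BSend _ _ _ _ => 2
  | CSend _ _ _ _ => 3
  end.

(* Time spent and resulting state; [None] means that the instruction is not
   available.  A call to a party costs what that party spends on the bit. *)
Definition step (ph : phase) (i : instr) (s : state) : option (nat * state) :=
  match i with
  | Const r k => Some (1, set_reg s r (k %% 2 ^ w))
  | Op o r a b => Some (1, set_reg s r (eval_binop w o (reg s a) (reg s b)))
  | Msb r a => Some (1, set_reg s r (trunc_log 2 (reg s a)))
  | Read r a k =>
      if (reg s k <= w) && (reg s a + reg s k <= space) then
        Some (1, set_reg s r (load_field (memory s) (reg s a) (reg s k)))
      else None
  | Write a k b =>
      if (reg s k <= w) && (reg s a + reg s k <= space) then
        Some (1, State (reg s) (store_field (memory s) (reg s a) (reg s k) (reg s b))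
                       (sim_adv s) (sim_node s) (reported s))
      else None
  | Start m =>
      Some ((advice_len pi).+1,
            State (reg s) (memory s) (advice_of_word (reg s m)) (tree pi) (reported s))
  | Turn r => Some (1, set_reg s r (turn_code (sim_node s)))
  | Move b =>
      match sim_node s with
      | Output _ _ => None
      | ASend _ _ t0 t1 | BSend _ _ t0 t1 | CSend _ _ t0 t1 =>
          Some (1, State (reg s) (memory s) (sim_adv s)
                         (if reg s b == 0 then t0 else t1) (reported s))
      end
  | AskAlice r i =>
      match ph, sim_node s, onth D (reg s i) with
      | Preprocess _ _, ASend msg steps _ _, Some x =>
          Some ((steps lam x (sim_adv s)).+1, set_reg s r (msg lam x (sim_adv s)))
      | _, _, _ => None
      end
  | AskBob r =>
      match ph, sim_node s with
      | Query y, BSend msg steps _ _ | Query y, Output msg steps =>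
          Some ((steps y (sim_adv s)).+1, set_reg s r (msg y (sim_adv s)))
      | _, _ => None
      end
  | AskCarol r =>
      match ph, sim_node s with
      | Preprocess rpub rpri, CSend msg steps _ _ =>
          Some ((steps lam rpub rpri).+1, set_reg s r (msg lam rpub rpri))
      | _, _ => None
      end
  | Test r i =>
      match ph, onth D (reg s i) with
      | Query y, Some x => Some (1, set_reg s r (f x y))
      | _, _ => None
      end
  | Report i =>
      match ph, onth D (reg s i) with
      | Query _, Some x =>
          Some (1, State (reg s) (memory s) (sim_adv s) (sim_node s)
                         (rcons (reported s) x))
      | _, _ => None
      end
  end.

(* [exec ph p s t s']: started in [s], [p] stops in [s'] after time [t]. *)
Inductive exec (ph : phase) : prog -> state -> nat -> state -> Prop :=
| exec_Skip s : exec ph Skip s 0 s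
| exec_Do i s t s' : step ph i s = Some (t, s') -> exec ph (Do i) s t s'
| exec_Seq p q s t s' t' s'' :
    exec ph p s t s' -> exec ph q s' t' s'' -> exec ph (Seq p q) s (t + t') s''
| exec_If r p q s t s' :
    exec ph (if reg s r == 0 then q else p) s t s' ->
    exec ph (If r p q) s t.+1 s'
| exec_While_stop r p s : reg s r = 0 -> exec ph (While r p) s 1 s
| exec_While_loop r p s t s' t' s'' :
    reg s r <> 0 -> exec ph p s t s' -> exec ph (While r p) s' t' s'' ->
    exec ph (While r p) s (t + t').+1 s''.

(* Registers 0, 1, ... initially hold the parameters [args], the others 0. *)
Definition start_state (args : seq nat) (g : nat -> bool) : state :=
  State (nth 0 args) g (advice_of_word 0) (tree pi) [::].

End Machine.

(* Main.v *)
Require Import Defs.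
From mathcomp Require Import all_boot all_order all_algebra finmap.
From mathcomp Require Import zify lra.
From Stdlib Require Import IndefiniteDescription.
Import Order.TTheory GRing.Theory Num.Theory.
Set Implicit Arguments.
Unset Strict Implicit.
Unset Printing Implicit Defensive.
Local Open Scope ring_scope.

(* Preprocessing fixes Carol's random strings.  For every advice m and every
   guess a, b of the bits of Alice and Bob it stores Carol's bits along the run
   (a, b) and the list of those x in D whose Alice sends a in this run.  A query
   tries all m and a, simulates the run with Bob's actual bits and Carol's stored
   ones, and goes through the list of that run if Bob accepts.  By type I error,
   every x with f x y = 1 is met under its special advice; the elements met in
   vain are charged to the error (special advice) or to the soundness (the at
   most 2^cm others).

   Two points are forced by the bit complexity.  A list must fit in O(n) bits and
   yet be enumerated in constant time per element, so it is stored as the sequence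
   of its gaps, a gap of g occupying O(log g) bits and being decoded with one
   most-significant-bit operation.  And an element met under several advices must
   be reported once, so reported elements are marked in a bitmap, which a second
   identical pass clears. *)

(** Bob's bits are guessed only during preprocessing. A query learns them one by one and lets them
    steer the record address, so the factor 2 ^ cb enters the space but not the query time. This
    works because the records of all guesses that extend the bits seen so far agree on Carol's bits
    up to that point.

    A guess of Alice's bits may be longer than what she sends, and then several guesses describe one
    run. Only the guess whose leftover is zero is accepted. An element is therefore met at most once
    per advice, and the number of meetings is at most the number of pairs (x, m) on which the
    protocol accepts. Its expectation is taken with lambda uniform on D, where n times the average
    error is a sum over D.

    Since programs may not depend on the protocol, their arithmetic is compiled from expressions and
    verified with timed triples in which no intermediate value may overflow a word. All these
    overflow conditions follow from the space being at most 2 ^ w. *)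

Inductive expr :=
| Var (r : nat)
| Cst (k : nat)
| Bin (o : binop) (e1 e2 : expr)
| Lg (e : expr).

(* Registers 0 .. 15 hold program variables, those from 16 on are temporaries
   of compiled expressions. *)
Notation nvars := 16%N (only parsing).

Declare Scope expr_scope.
Delimit Scope expr_scope with expr.
Bind Scope expr_scope with expr.
Notation "a + b" := (Bin Add a b) : expr_scope.
Notation "a - b" := (Bin Defs.Sub a b) : expr_scope.
Notation "a * b" := (Bin Mul a b) : expr_scope.
Notation "a == b" := (Bin Eqb a b) : expr_scope.
Notation "# k" := (Cst k) (at level 1, format "# k") : expr_scope.
Notation "$ r" := (Var r) (at level 1, format "$ r") : expr_scope.

(** * Compiled expressions and timed triples for the word-RAM *)

Section Compiler.
Local Open Scope nat_scope.

Definition natop (o : binop) (a b : nat) : nat :=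
  match o with
  | Add => a + b
  | Defs.Sub => a - b
  | Mul => a * b
  | Div => a %/ b
  | Mod => a %% b
  | Shl => a * 2 ^ b
  | Shr => a %/ 2 ^ b
  | And => Nat.land a b
  | Or => Nat.lor a b
  | Xor => Nat.lxor a b
  | Eqb => a == b
  | Ltb => a < b
  end.

Fixpoint value (l : seq nat) (e : expr) : nat :=
  match e with
  | Var r => nth 0 l r
  | Cst k => k
  | Bin o e1 e2 => natop o (value l e1) (value l e2)
  | Lg e1 => trunc_log 2 (value l e1)
  end.

(** Under this condition machine arithmetic modulo 2 ^ w agrees with [nat] arithmetic at every
    subexpression. Subtraction needs its own clause: it wraps on the machine but truncates in
    [nat]. *)
Fixpoint fits (w : nat) (l : seq nat) (e : expr) : bool :=
  (value l e < 2 ^ w) &&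
  match e with
  | Var _ | Cst _ => true
  | Bin o e1 e2 =>
      [&& fits w l e1, fits w l e2
        & if o is Defs.Sub then value l e2 <= value l e1 else true]
  | Lg e1 => fits w l e1
  end.

Fixpoint vars_below (k : nat) (e : expr) : bool :=
  match e with
  | Var r => r < k
  | Cst _ => true
  | Bin _ e1 e2 => vars_below k e1 && vars_below k e2
  | Lg e1 => vars_below k e1
  end.

(** Stack discipline: the result goes to register [d] and the right operand to [d.+1], so registers
    below [d] survive. With equal operands, [Or] acts as a move instruction. *)
Fixpoint compile (d : nat) (e : expr) : prog :=
  match e with
  | Var r => Do (Op Or d r r)
  | Cst k => Do (Const d k)
  | Bin o e1 e2 =>
      Seq (compile d e1) (Seq (compile d.+1 e2) (Do (Op o d d d.+1)))
  | Lg e1 => Seq (compile d e1) (Do (Msb d d))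
  end.

Fixpoint cost (e : expr) : nat :=
  match e with
  | Var _ | Cst _ => 1
  | Bin _ e1 e2 => cost e1 + (cost e2 + 1)
  | Lg e1 => cost e1 + 1
  end.

Lemma fits_lt w l e : fits w l e -> value l e < 2 ^ w.
Proof. by case: e => [r|k|o e1 e2|e] /= /andP[]. Qed.

Lemma eval_binop_natop w o a b :
  natop o a b < 2 ^ w -> (if o is Defs.Sub then b <= a else true) ->
  eval_binop w o a b = natop o a b.
Proof.
case: o => /= lt_w le_ba; rewrite /eval_binop; try exact: modn_small.
by rewrite -addnBAC // modnDr modn_small.
Qed.

Definition Assign x e := Seq (compile nvars e) (Do (Op Or x nvars nvars)).

Definition LoadBits x ea ek :=
  Seq (compile nvars ea) (Seq (compile nvars.+1 ek) (Do (Read x nvars nvars.+1))).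

Definition StoreBits ea ek ev :=
  Seq (compile nvars ea) (Seq (compile nvars.+1 ek)
    (Seq (compile nvars.+2 ev) (Do (Write nvars nvars.+1 nvars.+2)))).

Definition Cond e p q := Seq (compile nvars e) (If nvars p q).

Variables (R : realFieldType) (X : choiceType) (Y : Type).
Variables (f : X -> Y -> bool) (pi : protocol R X Y) (D : seq X).
Variables (lam : dist R X) (w space : nat) (ph : phase pi).

Local Notation exec := (exec f D lam w space ph).
Local Notation step := (step f D lam w space ph).
Local Notation tree_t := (ptree R X Y (Rpub pi) (Rpri pi) (advice_len pi)).

(* An abstract state fixes the variables but not the temporaries; [None] in the
   third field leaves the simulated run unspecified. *)
Record conf := Conf {
  cregs : seq nat;
  cmem : nat -> bool;
  csim : option (advice (advice_len pi) * tree_t);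
  crep : seq X
}.

Record agree (s : state pi) (c : conf) : Prop := Agree {
  agree_reg : forall i, i < nvars -> reg s i = nth 0 (cregs c) i;
  agree_mem : memory s =1 cmem c;
  agree_sim : if csim c is Some (m, t) then sim_adv s = m /\ sim_node s = t
              else True;
  agree_rep : reported s = crep c
}.

(** A total-correctness triple with a time bound. It holds for all states agreeing with [c], so
    triples compose without any account of the temporaries. *)
Definition reach (p : prog) (c : conf) (T : nat) (c' : conf) : Prop :=
  forall s, agree s c ->
  exists t s', [/\ exec p s t s', t <= T & agree s' c'].

Lemma reach_le p c T T' c' : reach p c T c' -> T <= T' -> reach p c T' c'.
Proof.
move=> pcc' le_TT' s /pcc'[t [s' [ex le_tT sc']]].
by exists t, s'; split=> //; apply: leq_trans le_TT'.
Qed.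

(** Memories are functions known only up to pointwise equality; triples have to be transported along
    it. *)
Lemma reach_mem p l g g' sim rep c T :
  reach p (Conf l g sim rep) T c -> g =1 g' -> reach p (Conf l g' sim rep) T c.
Proof.
move=> pc eq_g s [/= sl sg ss sr]; apply: pc.
by split=> //= j; rewrite sg eq_g.
Qed.

Lemma reach_skip l g g' sim rep :
  g =1 g' -> reach Skip (Conf l g sim rep) 0 (Conf l g' sim rep).
Proof.
move=> eq_g s [/= sl sg ss sr]; exists 0, s; split=> //; first exact: exec_Skip.
by split=> //= j; rewrite sg eq_g.
Qed.

(** Forgetting the simulated run lets loops over elements and codes return to one fixed form of
    configuration, whatever leaf was reached. *)
Lemma reach_forget l g sim rep :
  reach Skip (Conf l g sim rep) 0 (Conf l g None rep).
Proof.
by move=> s [/= sl sg ss sr]; exists 0, s; split=> //; exact: exec_Skip.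
Qed.

Lemma reach_seq p q c c1 c2 T1 T2 :
  reach p c T1 c1 -> reach q c1 T2 c2 -> reach (Seq p q) c (T1 + T2) c2.
Proof.
move=> pc qc s /pc[t1 [s1 [ex1 le1 /qc[t2 [s2 [ex2 le2 sc2]]]]]].
by exists (t1 + t2), s2; split=> //; [apply: exec_Seq ex1 ex2 | apply: leq_add].
Qed.

(** [Skip] leaves the state unchanged, so a triple for it with time 0 is an implication between
    configurations; this is the rule of consequence for postconditions. *)
Lemma reach_post p c T c1 c2 :
  reach p c T c1 -> reach Skip c1 0 c2 -> reach p c T c2.
Proof.
move=> pc qc s /pc[t1 [s1 [ex1 le1 /qc[t2 [s2 [ex2 le2 sc2]]]]]].
by exists t1, s1; split=> //; inversion ex2; subst.
Qed.

Lemma reach_if r p q l g sim rep c T :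
  r < nvars ->
  reach (if nth 0 l r == 0 then q else p) (Conf l g sim rep) T c ->
  reach (If r p q) (Conf l g sim rep) T.+1 c.
Proof.
move=> r_lt pc s sc; have [t [s' [ex le_tT sc']]] := pc s sc.
exists t.+1, s'; split=> //; apply: exec_If.
by rewrite (agree_reg sc r_lt).
Qed.

Lemma reach_while_stop r p l g sim rep :
  r < nvars -> nth 0 l r = 0 ->
  reach (While r p) (Conf l g sim rep) 1 (Conf l g sim rep).
Proof.
move=> r_lt r0 s sc; exists 1, s; split=> //; apply: exec_While_stop.
by rewrite (agree_reg sc r_lt).
Qed.

Lemma reach_while_loop r p l g sim rep c1 c2 T1 T2 :
  r < nvars -> nth 0 l r != 0 ->
  reach p (Conf l g sim rep) T1 c1 -> reach (While r p) c1 T2 c2 ->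
  reach (While r p) (Conf l g sim rep) (T1 + T2).+1 c2.
Proof.
move=> r_lt r0 pc qc s sc.
have /pc[t1 [s1 [ex1 le1 /qc[t2 [s2 [ex2 le2 sc2]]]]]] := sc.
exists (t1 + t2).+1, s2; split=> //; last by rewrite ltnS leq_add.
apply: exec_While_loop ex1 ex2.
by rewrite (agree_reg sc r_lt); apply/eqP.
Qed.

Lemma reach_step i l g sim rep c T :
  (forall s, agree s (Conf l g sim rep) ->
     exists t s', [/\ step i s = Some (t, s'), t <= T & agree s' c]) ->
  reach (Do i) (Conf l g sim rep) T c.
Proof.
move=> H s /H[t [s' [ex le_tT sc]]].
by exists t, s'; split=> //; apply: exec_Do.
Qed.

Lemma agree_set_reg s l g sim rep r v :
  agree s (Conf l g sim rep) ->
  agree (set_reg s r v) (Conf (set_nth 0 l r v) g sim rep).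
Proof.
move=> [/= sl sg ss sr]; split=> //= i i_lt.
by rewrite nth_set_nth /= /upd; case: eqP => // _; exact: sl.
Qed.

Lemma compileP d e s l :
  nvars <= d -> (forall i, i < nvars -> reg s i = nth 0 l i) ->
  vars_below nvars e -> fits w l e ->
  exists h, [/\ exec (compile d e) s (cost e)
                  (State h (memory s) (sim_adv s) (sim_node s) (reported s)),
                h d = value l e & forall j, j < d -> h j = reg s j].
Proof.
elim: e d s => [r|k|o e1 IH1 e2 IH2|e IH] d s d_ge sl /=.
- move=> r_lt /andP[lt_w _]; exists (upd (reg s) d (nth 0 l r)); split.
  + apply: exec_Do => /=; rewrite /set_reg sl //; congr (Some (_, State (upd _ _ _) _ _ _ _)).
    by rewrite eval_binop_natop /= ?PeanoNat.Nat.lor_diag.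
  + by rewrite /upd eqxx.
  + by move=> j j_lt; rewrite /upd ltn_eqF.
- move=> _ /andP[lt_w _]; exists (upd (reg s) d k); split.
  + by apply: exec_Do => /=; rewrite modn_small.
  + by rewrite /upd eqxx.
  + by move=> j j_lt; rewrite /upd ltn_eqF.
- move=> /andP[v1 v2] /and4P[lt_w f1 f2 sub_le].
  have [h1 [ex1 h1d h1j]] := IH1 d s d_ge sl v1 f1.
  set s1 := State h1 _ _ _ _ in ex1.
  have [|h2 [ex2 h2d h2j]] := IH2 d.+1 s1 (leqW d_ge) _ v2 f2.
    by move=> i i_lt; rewrite /= h1j ?sl // (leq_trans i_lt).
  exists (upd h2 d (natop o (value l e1) (value l e2))); split.
  + apply: exec_Seq ex1 _; apply: exec_Seq ex2 _; apply: exec_Do => /=.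
    by rewrite /set_reg /= h2j //= h1d h2d eval_binop_natop.
  + by rewrite /upd eqxx.
  + by move=> j j_lt; rewrite /upd ltn_eqF // h2j ?(ltnW j_lt) //= ?h1j // ltnS ltnW.
- move=> v1 /andP[lt_w f1]; have [h1 [ex1 h1d h1j]] := IH d s d_ge sl v1 f1.
  exists (upd h1 d (trunc_log 2 (value l e))); split.
  + by apply: exec_Seq ex1 _; apply: exec_Do => /=; rewrite /set_reg /= h1d.
  + by rewrite /upd eqxx.
  + by move=> j j_lt; rewrite /upd ltn_eqF // h1j.
Qed.

Lemma reach_assign x e l g sim rep :
  x < nvars -> vars_below nvars e -> fits w l e ->
  reach (Assign x e) (Conf l g sim rep) (cost e + 1)
    (Conf (set_nth 0 l x (value l e)) g sim rep).
Proof.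
move=> x_lt ve fe s sc.
have [h [ex hd hj]] := compileP (leqnn _) (agree_reg sc) ve fe.
exists (cost e + 1), (State (upd h x (value l e)) (memory s) (sim_adv s) (sim_node s) (reported s)).
split=> //.
  apply: exec_Seq ex _; apply: exec_Do; rewrite /= hd /set_reg /=.
  by rewrite eval_binop_natop /= ?PeanoNat.Nat.lor_diag // fits_lt.
case: sc => /= sl sg ss sr; split=> //= i i_lt.
by rewrite nth_set_nth /= /upd; case: eqP => // _; rewrite hj // sl.
Qed.

Lemma reach_cond e p q l g sim rep c T :
  vars_below nvars e -> fits w l e ->
  reach (if value l e == 0 then q else p) (Conf l g sim rep) T c ->
  reach (Cond e p q) (Conf l g sim rep) (cost e + T.+1) c.
Proof.
move=> ve fe pc s sc.
have [h [ex hd hj]] := compileP (leqnn _) (agree_reg sc) ve fe.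
have [|t [s' [ex' le_tT sc']]] :=
  pc (State h (memory s) (sim_adv s) (sim_node s) (reported s)).
  by case: sc => /= sl sg ss sr; split=> //= i i_lt; rewrite hj // sl.
exists (cost e + t.+1), s'; split=> //; last by rewrite leq_add2l.
by apply: exec_Seq ex _; apply: exec_If; rewrite /= hd.
Qed.

Lemma eq_load_field g g' a k :
  (forall j, j < k -> g (a + j) = g' (a + j)) ->
  load_field g a k = load_field g' a k.
Proof. by move=> eq_g; apply: eq_bigr => j _; rewrite eq_g. Qed.

Lemma reach_load x ea ek l g sim rep :
  x < nvars -> vars_below nvars ea -> vars_below nvars ek ->
  fits w l ea -> fits w l ek ->
  value l ek <= w -> value l ea + value l ek <= space ->
  reach (LoadBits x ea ek) (Conf l g sim rep) (cost ea + (cost ek + 1))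
    (Conf (set_nth 0 l x (load_field g (value l ea) (value l ek))) g sim rep).
Proof.
move=> x_lt va vk fa fk le_w le_s s sc.
have [h [ex hd hj]] := compileP (leqnn _) (agree_reg sc) va fa.
set s1 := State h _ _ _ _ in ex.
have [|h2 [ex2 h2d h2j]] := compileP (s := s1) (leqnSn _) _ vk fk.
  by move=> i i_lt; rewrite /= hj // (agree_reg sc).
pose v := load_field (memory s) (value l ea) (value l ek).
exists (cost ea + (cost ek + 1)),
  (State (upd h2 x v) (memory s) (sim_adv s) (sim_node s) (reported s)).
split=> //.
  apply: exec_Seq ex _; apply: exec_Seq ex2 _; apply: exec_Do => /=.
  by rewrite h2d h2j //= hd le_w le_s.
case: sc => /= sl sg ss sr; split=> //= i i_lt.
rewrite nth_set_nth /= /upd; case: eqP => // _.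
  by apply: eq_load_field => j _; exact: sg.
by rewrite h2j ?(leq_trans i_lt) //= hj // sl.
Qed.

Lemma reach_store ea ek ev l g sim rep :
  vars_below nvars ea -> vars_below nvars ek -> vars_below nvars ev ->
  fits w l ea -> fits w l ek -> fits w l ev ->
  value l ek <= w -> value l ea + value l ek <= space ->
  reach (StoreBits ea ek ev) (Conf l g sim rep) (cost ea + (cost ek + (cost ev + 1)))
    (Conf l (store_field g (value l ea) (value l ek) (value l ev)) sim rep).
Proof.
move=> va vk vv fa fk fv le_w le_s s sc.
have [h [ex hd hj]] := compileP (leqnn _) (agree_reg sc) va fa.
set s1 := State h _ _ _ _ in ex.
have [|h2 [ex2 h2d h2j]] := compileP (s := s1) (leqnSn _) _ vk fk.
  by move=> i i_lt; rewrite /= hj // (agree_reg sc).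
set s2 := State h2 _ _ _ _ in ex2.
have [|h3 [ex3 h3d h3j]] := compileP (s := s2) (leqW (leqnSn _)) _ vv fv.
  move=> i i_lt; rewrite /= h2j ?(leq_trans i_lt) //= hj // (agree_reg sc) //.
eexists _, (State h3 (store_field (memory s) _ _ _) (sim_adv s) (sim_node s) (reported s)).
split.
- apply: exec_Seq ex _; apply: exec_Seq ex2 _; apply: exec_Seq ex3 _.
  apply: exec_Do => /=.
  by rewrite h3d (h3j 17) //= h2d (h3j 16) //= h2j //= hd le_w le_s.
- by [].
case: sc => /= sl sg ss sr; split=> //=.
  move=> i i_lt.
  by rewrite h3j ?(leq_trans i_lt) //= h2j ?(leq_trans i_lt) //= hj // sl.
by move=> j; rewrite /store_field sg.
Qed.

Lemma reach_start r l g sim rep : r < nvars ->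
  reach (Do (Start r)) (Conf l g sim rep) (advice_len pi).+1
    (Conf l g (Some (advice_of_word pi (nth 0 l r), tree pi)) rep).
Proof.
move=> r_lt; apply: reach_step => s [/= sl sg ss sr].
by eexists _, _; split; [reflexivity | | split=> //=; rewrite sl].
Qed.

Lemma reach_turn r l g m t rep :
  reach (Do (Turn r)) (Conf l g (Some (m, t)) rep) 1
    (Conf (set_nth 0 l r (turn_code t)) g (Some (m, t)) rep).
Proof.
apply: reach_step => s sc; eexists _, _; split; [reflexivity | by [] | ].
by have [_ ->] := agree_sim sc; apply: agree_set_reg.
Qed.

Definition subtree (b : bool) (t : tree_t) : tree_t :=
  match t with
  | Output _ _ => t
  | ASend _ _ t0 t1 | BSend _ _ t0 t1 | CSend _ _ t0 t1 => if b then t1 else t0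
  end.

Lemma reach_move r l g m t rep : r < nvars -> turn_code t != 0 ->
  reach (Do (Move r)) (Conf l g (Some (m, t)) rep) 1
    (Conf l g (Some (m, subtree (nth 0 l r != 0) t)) rep).
Proof.
move=> r_lt t0; apply: reach_step => s sc.
have [sa sn] := agree_sim sc; rewrite /= sn (agree_reg sc r_lt) /=.
by case: t sn t0 sc => [o st|mg st t0 t1|mg st t0 t1|mg st t0 t1] //= sn _ sc;
   case: eqP => _; eexists _, _; split; try reflexivity; case: sc => *; split.
Qed.

End Compiler.

(** * Numbers as bit strings, and bit fields in memory *)

Section Bits.
Local Open Scope nat_scope.

Definition bits_value (k : nat) (g : nat -> bool) : nat := \sum_(j < k) g j * 2 ^ j.

Lemma bits_valueS k g :
  bits_value k.+1 g = g 0 + (bits_value k (fun j => g j.+1)).*2.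
Proof.
rewrite /bits_value big_ord_recl expn0 muln1 -muln2 big_distrl /=; congr (_ + _).
by apply: eq_bigr => j _; rewrite /bump /= expnS [2 * _]mulnC mulnA.
Qed.

Lemma bits_value_recr k g : bits_value k.+1 g = bits_value k g + g k * 2 ^ k.
Proof. by rewrite /bits_value big_ord_recr. Qed.

Lemma bits_value_lt k g : bits_value k g < 2 ^ k.
Proof.
elim: k g => [|k IH] g; first by rewrite /bits_value big_ord0.
by rewrite bits_value_recr expnS; have := IH g; case: (g k); lia.
Qed.

Lemma odd_divn_exp_bits_value k g j :
  j < k -> odd (bits_value k g %/ 2 ^ j) = g j.
Proof.
elim: k g j => // k IH g [|j] j_lt; rewrite bits_valueS.
  by rewrite expn0 divn1 oddD odd_double addbF oddb.
rewrite expnS divnMA; have -> : (g 0 + (bits_value k (fun j => g j.+1)).*2) %/ 2 =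
    bits_value k (fun j => g j.+1).
  by rewrite divn2 half_bit_double.
by rewrite IH.
Qed.

Lemma bits_value_odd k v : v < 2 ^ k -> bits_value k (fun j => odd (v %/ 2 ^ j)) = v.
Proof.
elim: k v => [|k IH] v.
  by rewrite expn0 ltnS leqn0 /bits_value big_ord0 => /eqP->.
rewrite expnS mul2n => v_lt; rewrite bits_valueS expn0 divn1.
have -> : bits_value k (fun j => odd (v %/ 2 ^ j.+1)) = v./2.
  rewrite -[RHS]IH ?ltn_half_double //; apply: eq_bigr => j _.
  by rewrite expnS divnMA divn2.
exact: odd_double_half.
Qed.

(** Lets one [Msb] instruction find the highest mark in a window of the record. *)
Lemma trunc_log_bits_value k (g : nat -> bool) i : i < k -> g i ->
  (forall j, i < j < k -> ~~ g j) -> trunc_log 2 (bits_value k g) = i.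
Proof.
move=> i_lt gi g0; have -> : bits_value k g = bits_value i.+1 g.
  elim: k i_lt g0 => // k IH; rewrite ltnS leq_eqVlt => /predU1P[-> //|i_lt] g0.
  rewrite bits_value_recr (negbTE (g0 k _)) ?i_lt ?leqnn // addn0 IH //.
  by move=> j /andP[ij jk]; rewrite g0 // ij ltnW.
apply: trunc_log_eq => //; rewrite bits_value_lt bits_value_recr gi mul1n.
by rewrite leq_addl.
Qed.

Lemma load_fieldE g a k : load_field g a k = bits_value k (fun j => g (a + j)).
Proof. by []. Qed.

Lemma load_field1 g a : load_field g a 1 = g a.
Proof. by rewrite /load_field big_ord1 addn0 expn0 muln1. Qed.

Definition put_bits (g : nat -> bool) (a : nat) (bs : seq bool) : nat -> bool :=
  fun j => if a <= j < a + size bs then nth false bs (j - a) else g j.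

(** Matches the walk through the tree, which stores Carol's bits one at a time from the front. *)
Lemma put_bits_cons g a (b : bool) bs :
  put_bits (store_field g a 1 b) a.+1 bs =1 put_bits g a (b :: bs).
Proof.
move=> j; rewrite /put_bits /store_field /=.
have [lt_ja|lt_aj|<-] := ltngtP j a.
- by do 2?[case: ifP => ?]; try case: ifP => ?; rewrite //; exfalso; lia.
- rewrite -(subnSK lt_aj) /=.
  by do 2?[case: ifP => ?]; try case: ifP => ?; rewrite //; exfalso; lia.
- rewrite subnn divn1 oddb /=.
  by do 2?[case: ifP => ?]; rewrite //; exfalso; lia.
Qed.

End Bits.

(** * Runs of the protocol with messages coded as numbers *)

Section TreeRuns.
Local Open Scope nat_scope.
Variables (R : realFieldType) (X : choiceType) (Y : Type).
Variables (Rpub Rpri : choiceType) (cm : nat).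
Variables (lam : dist R X) (rpub : Rpub) (rpri : Rpri).
Local Notation tree_t := (ptree R X Y Rpub Rpri cm).
Implicit Types (t : tree_t) (m : advice cm) (a b : nat).

(* The bits of a number, least significant first, are the messages of a party:
   [a] is a guess of Alice's messages, [b] of Bob's. *)

Fixpoint carol_bits t a b : seq bool :=
  match t with
  | Output _ _ => [::]
  | ASend _ _ t0 t1 => carol_bits (if odd a then t1 else t0) a./2 b
  | BSend _ _ t0 t1 => carol_bits (if odd b then t1 else t0) a b./2
  | CSend msg _ t0 t1 =>
      msg lam rpub rpri
        :: carol_bits (if msg lam rpub rpri then t1 else t0) a b
  end.

(** Leftover bits of [a] are not examined here: a query checks them by [rest], once Bob's actual
    bits fix the run. *)
Fixpoint follows (x : X) m t a b : bool :=
  match t with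
  | Output _ _ => true
  | ASend msg _ t0 t1 =>
      (msg lam x m == odd a) && follows x m (if odd a then t1 else t0) a./2 b
  | BSend _ _ t0 t1 => follows x m (if odd b then t1 else t0) a b./2
  | CSend msg _ t0 t1 =>
      follows x m (if msg lam rpub rpri then t1 else t0) a b
  end.

(* What remains of [a] when Bob's messages are those on query [y], and these
   messages themselves. *)
Fixpoint rest (y : Y) m t a : nat :=
  match t with
  | Output _ _ => a
  | ASend _ _ t0 t1 => rest y m (if odd a then t1 else t0) a./2
  | BSend msg _ t0 t1 => rest y m (if msg y m then t1 else t0) a
  | CSend msg _ t0 t1 => rest y m (if msg lam rpub rpri then t1 else t0) a
  end.

Fixpoint bob_code (y : Y) m t a : nat :=
  match t with
  | Output _ _ => 0
  | ASend _ _ t0 t1 => bob_code y m (if odd a then t1 else t0) a./2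
  | BSend msg _ t0 t1 =>
      msg y m + (bob_code y m (if msg y m then t1 else t0) a).*2
  | CSend msg _ t0 t1 => bob_code y m (if msg lam rpub rpri then t1 else t0) a
  end.

Fixpoint bob_output (y : Y) m t a : bool :=
  match t with
  | Output out _ => out y m
  | ASend _ _ t0 t1 => bob_output y m (if odd a then t1 else t0) a./2
  | BSend msg _ t0 t1 => bob_output y m (if msg y m then t1 else t0) a
  | CSend msg _ t0 t1 => bob_output y m (if msg lam rpub rpri then t1 else t0) a
  end.

Fixpoint leaf (y : Y) m t a : tree_t :=
  match t with
  | Output _ _ => t
  | ASend _ _ t0 t1 => leaf y m (if odd a then t1 else t0) a./2
  | BSend msg _ t0 t1 => leaf y m (if msg y m then t1 else t0) a
  | CSend msg _ t0 t1 => leaf y m (if msg lam rpub rpri then t1 else t0) a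
  end.

Fixpoint alice_code (x : X) (y : Y) m t : nat :=
  match t with
  | Output _ _ => 0
  | ASend msg _ t0 t1 =>
      msg lam x m + (alice_code x y m (if msg lam x m then t1 else t0)).*2
  | BSend msg _ t0 t1 => alice_code x y m (if msg y m then t1 else t0)
  | CSend msg _ t0 t1 => alice_code x y m (if msg lam rpub rpri then t1 else t0)
  end.

Lemma bits_sent_if p (t0 t1 : tree_t) (b : bool) :
  bits_sent p (if b then t1 else t0) <= maxn (bits_sent p t0) (bits_sent p t1).
Proof. by case: b; rewrite ?leq_maxl ?leq_maxr. Qed.

Lemma size_carol_bits t a b : size (carol_bits t a b) <= bits_sent Carol t.
Proof.
elim: t a b => [o st|msg st t0 IH0 t1 IH1|msg st t0 IH0 t1 IH1|msg st t0 IH0 t1 IH1] a b //=;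
  rewrite ?add0n ?add1n ?ltnS; case: ifP => _;
  by rewrite leq_max ?IH0 ?IH1 ?orbT.
Qed.

Lemma bob_code_lt y m t a : bob_code y m t a < 2 ^ bits_sent Bob t.
Proof.
elim: t a => [o st|msg st t0 IH0 t1 IH1|msg st t0 IH0 t1 IH1|msg st t0 IH0 t1 IH1] a //=.
- set b := odd a; apply: leq_trans (_ : 2 ^ bits_sent Bob (if b then t1 else t0) <= _).
    by case: b.
  by rewrite leq_exp2l // add0n bits_sent_if.
- set b := msg y m; rewrite add1n expnS.
  have := leq_pexp2l (isT : 0 < 2) (bits_sent_if Bob t0 t1 b).
  by case: b => /=; [have := IH1 a | have := IH0 a]; lia.
- set b := msg _ _ _; apply: leq_trans (_ : 2 ^ bits_sent Bob (if b then t1 else t0) <= _).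
    by case: b.
  by rewrite leq_exp2l // add0n bits_sent_if.
Qed.

Lemma alice_code_lt x y m t : alice_code x y m t < 2 ^ bits_sent Alice t.
Proof.
elim: t => [o st|msg st t0 IH0 t1 IH1|msg st t0 IH0 t1 IH1|msg st t0 IH0 t1 IH1] //=.
- set b := msg _ _ _; rewrite add1n expnS.
  have := leq_pexp2l (isT : 0 < 2) (bits_sent_if Alice t0 t1 b).
  by case: b => /=; lia.
- set b := msg _ _; apply: leq_trans (_ : 2 ^ bits_sent Alice (if b then t1 else t0) <= _).
    by case: b.
  by rewrite leq_exp2l // add0n bits_sent_if.
- set b := msg _ _ _; apply: leq_trans (_ : 2 ^ bits_sent Alice (if b then t1 else t0) <= _).
    by case: b.
  by rewrite leq_exp2l // add0n bits_sent_if.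
Qed.

(** A guess that Alice follows starts with her actual bits, and a zero [rest] excludes any surplus,
    so the guess is her code itself. Without the condition on [rest], each padding of her code by
    surplus bits would meet the element again. *)
Lemma accept_code x y m t a :
  [&& rest y m t a == 0, bob_output y m t a & follows x m t a (bob_code y m t a)]
  = (a == alice_code x y m t) && run lam x y m rpub rpri t.
Proof.
elim: t a => [o st|msg st t0 IH0 t1 IH1|msg st t0 IH0 t1 IH1|msg st t0 IH0 t1 IH1] a /=.
- by rewrite andbT.
- have -> : forall c, (a == msg lam x m + c.*2) = (odd a == msg lam x m) && (a./2 == c).
    by move=> c; case: (msg _ _ _); case: eqP; case: eqP; case: eqP; lia.
  rewrite (eq_sym (odd a)); case: (msg lam x m); case: (odd a) => //=.
  + by rewrite !andbF.
  + by rewrite !andbF.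
- rewrite half_bit_double oddD odd_double addbF oddb.
  by case: (msg y m).
- by case: (msg _ _ _).
Qed.

End TreeRuns.

(* The preprocessing and query programs *)
Declare Scope prog_scope.
Delimit Scope prog_scope with prog.
Notation "p ;; q" := (Seq p q) (at level 90, right associativity) : prog_scope.
Notation "x ::= e" := (Assign x e) (at level 85) : prog_scope.

(* Registers 8, 13 and 15 have different roles in the two programs. *)
Notation rn := 0%N (only parsing).
Notation rca := 1%N (only parsing).
Notation rcb := 2%N (only parsing).
Notation rcc := 3%N (only parsing).
Notation rcm := 4%N (only parsing).
Notation rcode := 5%N (only parsing).
Notation ra := 6%N (only parsing).
Notation rbase := 7%N (only parsing).
Notation rb := 8%N (only parsing).
Notation rweight := 8%N (only parsing).
Notation rj := 9%N (only parsing).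
Notation rturn := 10%N (only parsing).
Notation rbit := 11%N (only parsing).
Notation rcur := 12%N (only parsing).
Notation rp := 13%N (only parsing).
Notation rz := 13%N (only parsing).
Notation ri := 14%N (only parsing).
Notation rok := 15%N (only parsing).
Notation rgap := 15%N (only parsing).

(* The code of advice m and guesses a, b is c = m + a * 2^cm + b * 2^(ca+cm).
   Memory: a bitmap of N = n + 2 bits, then one record of stride 2N + cc for each
   code c, made of N bits for gaps, N bits for marks and cc bits of Carol. *)
Definition eN : expr := $rn + #2.
Definition eS : expr := eN * #2 + $rcc.

Section Programs.
Local Open Scope prog_scope.

(** After Alice's first mismatch the walk goes on, since Carol's bits are stored for every guessed
    run, but Alice is no longer asked. Her time is thus charged only along messages she really
    sends. Registers are cleared after use so that invariants can be stated with literal zeros. *)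
Definition build_step : prog :=
  Cond ($rturn == #1)
    (rbit ::= Bin Mod $ra #2;;
     ra ::= Bin Div $ra #2;;
     If rok (Do (AskAlice rok ri);; rok ::= ($rok == $rbit)) Skip)
    (Cond ($rturn == #2)
       (rbit ::= Bin Mod $rb #2;;
        rb ::= Bin Div $rb #2)
       (Do (AskCarol rbit);;
        StoreBits ($rbase + eN * #2 + $rj) #1 $rbit;;
        rj ::= ($rj + #1)));;
  Do (Move rbit);;
  rbit ::= #0;;
  Do (Turn rturn).

Definition emit : prog :=
  StoreBits ($rbase + $rcur - Lg ($rcur - $rp)) (Lg ($rcur - $rp) + #1) ($rcur - $rp);;
  StoreBits ($rbase + eN + $rcur - Lg ($rcur - $rp)) #1 #1;;
  rcur ::= $rp.

(** The code is not masked: [ra] also carries Bob's guess above Alice's [ca] bits and [Start]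
    receives the whole code. The surplus is never read, as Alice sends at most [ca] bits and the
    advice takes the low [cm] bits. *)
Definition build_element : prog :=
  ri ::= ($rp - #1);;
  ra ::= Bin Shr $rcode $rcm;;
  rb ::= Bin Shr $rcode ($rca + $rcm);;
  rok ::= #1;;
  Do (Start rcode);;
  Do (Turn rturn);;
  While rturn build_step;;
  ra ::= #0;;
  rb ::= #0;;
  rj ::= #0;;
  If rok emit Skip;;
  rok ::= #0;;
  ri ::= #0;;
  rp ::= ($rp - #1).

(** The element of index p - 1 has position p. Position n + 1 is the entry from which the list
    starts and position 0 ends it, so n + 2 positions are needed. The final [emit], run with [rp] at
    0, writes the closing gap. *)
Definition build_record : prog :=
  rcode ::= ($rcode - #1);;
  rbase ::= (eN + $rcode * eS);;
  rp ::= $rn;;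
  rcur ::= ($rn + #1);;
  While rp build_element;;
  emit;;
  rbase ::= #0;;
  rcur ::= #0.

Definition preprocess : prog :=
  rcode ::= Bin Shl #1 ($rca + $rcb + $rcm);;
  While rcode build_record.

(** Each bit of Bob moves [rbase] to the record of the code extended by this bit, [rweight] being
    the distance in memory that the bit stands for. The offset [rj] of Carol's next bit stays valid
    after the jump. *)
Definition query_step : prog :=
  Cond ($rturn == #1)
    (rbit ::= Bin Mod $ra #2;;
     ra ::= Bin Div $ra #2)
    (Cond ($rturn == #2)
       (Do (AskBob rbit);;
        rbase ::= ($rbase + $rbit * $rweight);;
        rweight ::= ($rweight * #2))
       (LoadBits rbit ($rbase + eN * #2 + $rj) #1;;
        rj ::= ($rj + #1)));;
  Do (Move rbit);;
  rbit ::= #0;;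
  Do (Turn rturn).

Definition eL : expr := Lg ($rn + #1).

Definition next_entry : prog :=
  LoadBits rz ($rbase + eN + $rcur - eL) (eL + #1);;
  rz ::= (eL - Lg $rz);;
  LoadBits rgap ($rbase + $rcur - $rz) ($rz + #1);;
  rcur ::= ($rcur - $rgap);;
  rz ::= #0;;
  rgap ::= #0.

(** The bitmap starts at address 0, so a position is its own address in it. Only elements that pass
    the test are marked. *)
Definition report_new : prog :=
  LoadBits rbit $rcur #1;;
  Cond ($rbit == #0)
    (ri ::= ($rcur - #1);;
     Do (Test rbit ri);;
     If rbit (StoreBits $rcur #1 #1;; Do (Report ri)) Skip;;
     ri ::= #0)
    Skip;;
  rbit ::= #0.

Definition unmark : prog := StoreBits $rcur #1 #0.

Section Pass.
Variable visit : prog.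

Definition query_list : prog :=
  rcur ::= ($rn + #1);;
  next_entry;;
  While rcur (visit;; next_entry).

(** [rbase] starts at the record in which all bits of Bob are 0. The factor [$ra == #0] rejects
    guesses with a nonzero leftover. *)
Definition query_code : prog :=
  rcode ::= ($rcode - #1);;
  ra ::= Bin Shr $rcode $rcm;;
  rbase ::= (eN + $rcode * eS);;
  rweight ::= Bin Shl eS ($rca + $rcm);;
  Do (Start rcode);;
  Do (Turn rturn);;
  While rturn query_step;;
  rweight ::= #0;;
  rj ::= #0;;
  Do (AskBob rbit);;
  rbit ::= ($rbit * ($ra == #0));;
  ra ::= #0;;
  Cond $rbit (rbit ::= #0;; query_list) Skip;;
  rbit ::= #0;;
  rbase ::= #0.

Definition query_pass : prog :=
  rcode ::= Bin Shl #1 ($rca + $rcm);;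
  While rcode query_code.

End Pass.

Definition query : prog := query_pass report_new;; query_pass unmark.

End Programs.

Section Advance.
Local Open Scope nat_scope.

Lemma reach_advance (R : realFieldType) (X : choiceType) (Y : Type)
    (f : X -> Y -> bool) (pi : protocol R X Y) (D : seq X) (lam : dist R X)
    (w space : nat) (ph : phase pi) l g m t rep :
  (nth 0 l rbit < 2) -> turn_code t != 0 -> 0 < w ->
  reach f D lam w space ph (Do (Move rbit);; rbit ::= #0;; Do (Turn rturn))%prog
    (Conf l g (Some (m, t)) rep) 4
    (Conf (set_nth 0 (set_nth 0 l rbit 0) rturn
             (turn_code (subtree (nth 0 l rbit == 1) t)))
          g (Some (m, subtree (nth 0 l rbit == 1) t)) rep).
Proof.
move=> bit_lt t0 w_gt0; eapply reach_le.
  eapply reach_seq; first by apply: reach_move.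
  eapply reach_seq; first by apply: reach_assign => //=; rewrite expn_gt0.
  have -> : (nth 0 l rbit == 1) = (nth 0 l rbit != 0).
    by case: (nth 0 l rbit) bit_lt => [|[]].
  exact: reach_turn.
by [].
Qed.

End Advance.

(** * Lists of positions coded by their gaps *)

Section Gaps.
Local Open Scope nat_scope.
Variable N : nat.

(* The list of positions of a record is stored downwards: an entry h > p, where
   p is the next entry, occupies bits p+1 .. h.  With z = log2 (h - p), the z + 1
   low bits of the gap end at h, and the only mark above p is at h - z, so the
   most significant bit of a window of marks ending at h reveals z. *)
Definition gap (g : nat -> bool) (bs h p : nat) : bool :=
  let z := trunc_log 2 (h - p) in
  [&& p < h, load_field g (bs + h - z) z.+1 == h - p, g (bs + N + h - z)
    & all (fun j => ~~ g (bs + N + h - j)) (iota 0 z)].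

Definition store_gap (g : nat -> bool) (bs h p : nat) : nat -> bool :=
  let z := trunc_log 2 (h - p) in
  store_field (store_field g (bs + h - z) z.+1 (h - p)) (bs + N + h - z) 1 1.

Lemma trunc_log_lt x : 0 < x -> trunc_log 2 x < x.
Proof. by move=> x_gt0; apply: leq_trans (trunc_logP (isT : 1 < 2) x_gt0); exact: ltn_expl. Qed.

Lemma gap_lt g bs h p : gap g bs h p -> p < h.
Proof. by case/and4P. Qed.

(** From 2 ^ z <= h - p follows z < h - p, so both the field and its mark stay within positions p +
    1 .. h. Hence consecutive gaps use disjoint bits, and a whole list fits in [N] bits of each
    kind. *)
Lemma eq_gap g g' bs h p :
  (forall k, p < k <= h -> g (bs + k) = g' (bs + k)) ->
  (forall k, p < k <= h -> g (bs + N + k) = g' (bs + N + k)) ->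
  gap g bs h p -> gap g' bs h p.
Proof.
move=> eqA eqB; rewrite /gap; set z := trunc_log 2 (h - p) => /and4P[ph ld mk al].
have z_lt : z < h - p by apply: trunc_log_lt; lia.
apply/and4P; split=> //.
- rewrite -(eqP ld); apply/eqP/eq_load_field => j j_lt.
  have -> : bs + h - z + j = bs + (h - z + j) by lia.
  by rewrite eqA //; lia.
- move: mk; have -> : bs + N + h - z = bs + N + (h - z) by lia.
  by rewrite eqB //; lia.
- apply/allP => j j_in; move/allP/(_ j j_in): al; move: j_in; rewrite mem_iota => j_lt.
  have -> : bs + N + h - j = bs + N + (h - j) by lia.
  by rewrite eqB //; lia.
Qed.

(** The marks up to [h] must be clear beforehand, because decoding relies on the new mark being the
    highest one at or below [h]. *)
Lemma gap_store g bs h p : p < h < N ->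
  (forall k, k <= h -> g (bs + N + k) = false) -> gap (store_gap g bs h p) bs h p.
Proof.
move=> /andP[ph hN] g0; rewrite /gap /store_gap; set z := trunc_log 2 (h - p).
have z_lt : z < h - p by apply: trunc_log_lt; lia.
have hp_lt : h - p < 2 ^ z.+1 by apply: trunc_log_ltn.
apply/and4P; split=> //.
- rewrite -{2}(bits_value_odd hp_lt) load_fieldE; apply/eqP.
  apply: eq_bigr => -[j j_lt] _ /=; congr (nat_of_bool _ * _); rewrite /store_field.
  case: ifP => [|_]; first lia.
  case: ifP => [_|]; last lia.
  by congr (odd (_ %/ 2 ^ _)); lia.
- by rewrite /store_field; case: ifP => [_|]; [rewrite subnn | lia].
- apply/allP => j; rewrite mem_iota => j_lt; rewrite /store_field.
  case: ifP => [|_]; first lia.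
  case: ifP => [|_]; first lia.
  have -> : bs + N + h - j = bs + N + (h - j) by lia.
  by rewrite g0 //; lia.
Qed.

Lemma store_gap_out g bs h p j : p < h < N ->
  ~~ (bs + p < j <= bs + h) -> ~~ (bs + N + p < j <= bs + N + h) ->
  store_gap g bs h p j = g j.
Proof.
move=> ph jA jB; rewrite /store_gap; set z := trunc_log 2 (h - p).
have z_lt : z < h - p by apply: trunc_log_lt; lia.
rewrite /store_field; case: ifP => [|_]; first lia.
by case: ifP => [|_]; first lia.
Qed.

Lemma path_gap_last_le g bs h ps : path (gap g bs) h ps -> last h ps <= h.
Proof.
elim: ps h => //= p ps IH h /andP[/gap_lt ph /IH]; lia.
Qed.

Lemma eq_path_gap g g' bs h ps :
  (forall k, last h ps < k <= h -> g (bs + k) = g' (bs + k)) ->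
  (forall k, last h ps < k <= h -> g (bs + N + k) = g' (bs + N + k)) ->
  path (gap g bs) h ps -> path (gap g' bs) h ps.
Proof.
elim: ps h => //= p ps IH h eqA eqB /andP[hp ps_path].
have lt_ph := gap_lt hp; have le_p := path_gap_last_le ps_path.
rewrite (IH p) ?andbT //; last 2 first.
- by move=> k k_lt; apply: eqA; lia.
- by move=> k k_lt; apply: eqB; lia.
by apply: eq_gap hp => k k_lt; [apply: eqA | apply: eqB]; lia.
Qed.

End Gaps.

(** * Correctness and time of preprocessing *)

Section Preprocessing.
Local Open Scope nat_scope.
Variables (R : realFieldType) (X : choiceType) (Y : Type).
Variables (f : X -> Y -> bool) (pi : protocol R X Y) (D : seq X).
Variables (lam : dist R X) (w space : nat).
Variables (ca cb cc : nat) (rpub : Rpub pi) (rpri : Rpri pi).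
Local Notation n := (size D).
Local Notation cm := (advice_len pi).
Local Notation N := (n + 2).
Local Notation S := (N * 2 + cc).
Local Notation Q := (2 ^ (ca + cb + cm)).
Hypothesis space_ge : N + Q * S <= space.
Hypothesis space_le : space <= 2 ^ w.

Local Notation reach := (reach f D lam w space (Preprocess rpub rpri)).
Local Notation regs c a bs b j t u cur p i ok :=
  [:: n; ca; cb; cc; cm; c; a; bs; b; j; t; u; cur; p; i; nat_of_bool ok].

Lemma reach_ask_alice r i x l g m msg st t0 t1 rep :
  i < nvars -> onth D (nth 0 l i) = Some x ->
  reach (Do (AskAlice r i)) (Conf l g (Some (m, ASend msg st t0 t1)) rep)
    (st lam x m).+1
    (Conf (set_nth 0 l r (msg lam x m)) g (Some (m, ASend msg st t0 t1)) rep).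
Proof.
move=> i_lt Di; apply: reach_step => s sc.
have [sa sn] := agree_sim sc; rewrite /= sn (agree_reg sc i_lt) /= Di sa.
by eexists _, _; split; [reflexivity | by [] | apply: agree_set_reg].
Qed.

Lemma reach_ask_carol r l g m msg st t0 t1 rep :
  reach (Do (AskCarol r)) (Conf l g (Some (m, CSend msg st t0 t1)) rep)
    (st lam rpub rpri).+1
    (Conf (set_nth 0 l r (msg lam rpub rpri)) g (Some (m, CSend msg st t0 t1)) rep).
Proof.
apply: reach_step => s sc.
have [sa sn] := agree_sim sc; rewrite /= sn /=.
by eexists _, _; split; [reflexivity | by [] | apply: agree_set_reg].
Qed.

Ltac fit := rewrite /fits /=; lia.
Ltac asg := eapply reach_seq; [eapply reach_assign; [done|done|fit] | simpl].
Ltac asg_last := eapply reach_assign; [done|done|fit].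

Lemma nat_of_bool_inj : injective nat_of_bool.
Proof. by case; case. Qed.

(** The constant 100 covers one iteration of [build_step] apart from the parties' own steps; on a
    bit of Carol it is paid by [carol_time], which counts at least 1 per bit. Alice's time is
    charged only while [ok] holds. The values left in [a'], [b'], [j'] do not matter, as they are
    cleared afterwards. *)
Definition build_walk_spec i x m c bs cur p t := forall a b j (ok : bool) g,
  j + bits_sent Carol t <= cc ->
  [&& c < 2 ^ w, a < 2 ^ w, b < 2 ^ w, cur < 2 ^ w, p < 2 ^ w & i < 2 ^ w] ->
  exists a' b' j', reach (While rturn build_step)
    (Conf (regs c a bs b j (turn_code t) 0 cur p i ok) g (Some (m, t)) [::])
    (100 * (1 + bits_sent Alice t + bits_sent Bob t + carol_time lam rpub rpri t)
     + ok * alice_time lam x m t)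
    (Conf (regs c a' bs b' j' 0 0 cur p i (ok && follows lam rpub rpri x m t a b))
       (put_bits g (bs + N * 2 + j) (carol_bits lam rpub rpri t a b)) None [::]).

Lemma build_walk i x m c bs cur p t :
  onth D i = Some x -> bs + S <= space -> build_walk_spec i x m c bs cur p t.
Proof.
move=> Di bs_le; have w_gt0 : 0 < w by case: (w) space_le => //; lia.
elim: t => [o st|msg st t0 IH0 t1 IH1|msg st t0 IH0 t1 IH1|msg st t0 IH0 t1 IH1]
  a b j ok g j_le lt_w.
- exists a, b, j; rewrite andbT.
  eapply reach_le; first eapply reach_post.
  + exact: reach_while_stop.
  + eapply reach_post; first exact: reach_forget.
    apply: reach_skip => k; rewrite /put_bits /=; case: ifP => //; lia.
  + lia.
- have : build_walk_spec i x m c bs cur p (if odd a then t1 else t0) by case: ifP.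
  move/(_ a./2 b j (ok && (msg lam x m == odd a)) g) => IH.
  have le_A := bits_sent_if Alice t0 t1 (odd a).
  have le_B := bits_sent_if Bob t0 t1 (odd a).
  have le_C := bits_sent_if Carol t0 t1 (odd a).
  rewrite /= in j_le; have [||a' [b' [j' {}IH]]] := IH; try lia.
  have ask : reach (If rok (Do (AskAlice rok ri);; rok ::= ($rok == $rbit)) Skip)%prog
      (Conf (regs c a./2 bs b j 1 (nat_of_bool (odd a)) cur p i ok) g
         (Some (m, ASend msg st t0 t1)) [::])
      ((st lam x m + 6) * ok).+1
      (Conf (regs c a./2 bs b j 1 (nat_of_bool (odd a)) cur p i (ok && (msg lam x m == odd a))) g
         (Some (m, ASend msg st t0 t1)) [::]).
    apply: reach_if => //=; case: (ok) => /=; last first.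
      by eapply reach_le; [apply: reach_skip | ].
    have [u_lt v_lt] : msg lam x m < 2 ^ w /\ odd a < 2 ^ w.
      by split; [case: (msg lam x m) | case: (odd a)]; lia.
    eapply reach_le.
      eapply reach_seq; first (eapply reach_ask_alice; [done | exact: Di]).
      simpl; eapply reach_post; first asg_last.
      by rewrite /= (inj_eq nat_of_bool_inj); exact: reach_skip.
    by rewrite /=; lia.
  exists a', b', j'; eapply reach_le.
    rewrite /= andbA; eapply reach_while_loop; [done | done | | exact: IH].
    eapply reach_seq.
      eapply reach_cond; [done | fit | simpl].
      asg; asg; rewrite /= modn2 divn2; exact: ask.
    eapply reach_post; first by apply: reach_advance => //=; case: (odd a).
    by rewrite /= eqb1; exact: reach_skip.
  rewrite /=.
  have : carol_time lam rpub rpri (if odd a then t1 else t0) <=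
     maxn (carol_time lam rpub rpri t0) (carol_time lam rpub rpri t1).
    by case: ifP; lia.
  case: (ok) => /=; last lia.
  by case: (msg lam x m); case: (odd a) le_A le_B le_C => /=; lia.
- have : build_walk_spec i x m c bs cur p (if odd b then t1 else t0) by case: ifP.
  move/(_ a b./2 j ok g) => IH.
  have le_A := bits_sent_if Alice t0 t1 (odd b).
  have le_B := bits_sent_if Bob t0 t1 (odd b).
  have le_C := bits_sent_if Carol t0 t1 (odd b).
  rewrite /= in j_le; have [||a' [b' [j' {}IH]]] := IH; try lia.
  exists a', b', j'; eapply reach_le.
    rewrite /=; eapply reach_while_loop; [done | done | | exact: IH].
    eapply reach_seq.
      eapply reach_cond; [done | fit | simpl].
      eapply reach_cond; [done | fit | simpl].
      by asg; asg_last.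
    rewrite /= modn2 divn2.
    eapply reach_post; first by apply: reach_advance => //=; case: (odd b).
    by rewrite /= eqb1; exact: reach_skip.
  rewrite /=.
  have : carol_time lam rpub rpri (if odd b then t1 else t0) <=
     maxn (carol_time lam rpub rpri t0) (carol_time lam rpub rpri t1).
    by case: ifP; lia.
  have : alice_time lam x m (if odd b then t1 else t0) <=
     maxn (alice_time lam x m t0) (alice_time lam x m t1).
    by case: ifP; lia.
  by case: (ok) => /=; lia.
- pose u := msg lam rpub rpri.
  have : build_walk_spec i x m c bs cur p (if u then t1 else t0) by case: ifP.
  move/(_ a b j.+1 ok (store_field g (bs + N * 2 + j) 1 u)) => IH.
  have le_A := bits_sent_if Alice t0 t1 u.
  have le_B := bits_sent_if Bob t0 t1 u.
  have le_C := bits_sent_if Carol t0 t1 u.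
  rewrite /= in j_le; have [||a' [b' [j' {}IH]]] := IH; try lia.
  exists a', b', j'; eapply reach_le.
    rewrite /= -/u; eapply reach_while_loop; [done | done | | ]; last first.
      eapply reach_post; first exact: IH.
      by apply: reach_skip => k; rewrite (addnS (bs + N * 2)) put_bits_cons.
    eapply reach_seq.
      eapply reach_cond; [done | fit | simpl].
      eapply reach_cond; [done | fit | simpl].
      eapply reach_seq; first exact: reach_ask_carol.
      rewrite /= -/u; eapply reach_seq.
        have u_lt : u < 2 ^ w by case: (u); lia.
        by eapply reach_store => //; [fit | fit | fit | rewrite /=; lia].
      by rewrite /=; asg_last.
    rewrite /= addn1.
    eapply reach_post; first by apply: reach_advance => //=; case: (u).
    by rewrite /= eqb1; exact: reach_skip.
  rewrite /= -/u.
  have : alice_time lam x m (if u then t1 else t0) <=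
     maxn (alice_time lam x m t0) (alice_time lam x m t1).
    by case: ifP; lia.
  by case: (u) le_A le_B le_C; case: (ok) => /=; lia.
Qed.

(** A gap field of z + 1 bits must fit in one word. Here 2 ^ (z + 1) <= 2 (n + 1), which is below
    the space and so below 2 ^ w. *)
Lemma trunc_log_le_w x : x <= n.+1 -> trunc_log 2 x < w.
Proof.
move=> x_le; have [->|x_gt0] := posnP x.
  by rewrite trunc_log0; case: (w) space_le => //; lia.
rewrite -(leq_exp2l (m := 2)) //; apply: leq_trans (_ : (n + 2) * 2 <= _).
  by rewrite expnS; have := trunc_logP (isT : 1 < 2) x_gt0; lia.
have : 0 < Q by rewrite expn_gt0.
by case: Q space_ge => // q; rewrite mulSn; lia.
Qed.

Lemma reach_emit c a bs b j t u cur p i (ok : bool) g sim rep :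
  p < cur <= n.+1 -> bs + S <= space ->
  reach emit (Conf (regs c a bs b j t u cur p i ok) g sim rep) 60
    (Conf (regs c a bs b j t u p p i ok) (store_gap N g bs cur p) sim rep).
Proof.
move=> cur_lt bs_le.
have z_w : trunc_log 2 (cur - p) < w by apply: trunc_log_le_w; lia.
have z_lt : trunc_log 2 (cur - p) < cur - p by apply: trunc_log_lt; lia.
have w_lt : w < 2 ^ w := ltn_expl w (ltnSn 1).
eapply reach_le.
  eapply reach_seq.
    eapply reach_store; [done|done|done|fit|fit|fit|rewrite /=; lia|rewrite /=; lia].
  eapply reach_seq.
    eapply reach_store; [done|done|done|fit|fit|fit|rewrite /=; lia|rewrite /=; lia].
  eapply reach_post; first asg_last.
  by apply: reach_skip => k; rewrite /= /store_gap addn1.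
by [].
Qed.

Variables (x0 : X) (ta tc : nat).
Hypothesis D_gt0 : 0 < n.
Hypothesis alice_bits : bits_sent Alice (tree pi) <= ca.
Hypothesis bob_bits : bits_sent Bob (tree pi) <= cb.
Hypothesis carol_bits_le : bits_sent Carol (tree pi) <= cc.
Hypothesis alice_time_le :
  forall x m, x \in D -> alice_time lam x m (tree pi) <= ta.
Hypothesis carol_time_le : carol_time lam rpub rpri (tree pi) <= tc.

Definition record_address c := N + c * S.

Definition matches c p : bool :=
  follows lam rpub rpri (nth x0 D p.-1) (advice_of_word pi c) (tree pi)
    (c %/ 2 ^ cm) (c %/ 2 ^ (ca + cm)).

Definition stored_carol c : seq bool :=
  carol_bits lam rpub rpri (tree pi) (c %/ 2 ^ cm) (c %/ 2 ^ (ca + cm)).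

(** The list as it stands once the downward loop has treated all positions above [k]. *)
Definition positions_from c k := [seq p <- rev (iota k.+1 (n - k)) | matches c p].

Definition has_carol (g : nat -> bool) c := forall j, j < size (stored_carol c) ->
  g (record_address c + N * 2 + j) = nth false (stored_carol c) j.

Definition good_record g c :=
  path (gap N g (record_address c)) n.+1 (rcons (positions_from c 0) 0)
  /\ has_carol g c.

Lemma size_stored_carol c : size (stored_carol c) <= cc.
Proof. exact: leq_trans (size_carol_bits _ _ _ _ _ _) carol_bits_le. Qed.

Lemma record_address_le c : c < Q -> record_address c + S <= space.
Proof.
move=> c_lt; apply: leq_trans space_ge; rewrite /record_address -addnA leq_add2l.
by rewrite addnC -mulSn leq_mul2r c_lt orbT.
Qed.

Lemma record_address_lt c c' : c < c' -> record_address c + S <= record_address c'.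
Proof.
move=> c_lt; rewrite /record_address -addnA leq_add2l.
by rewrite addnC -mulSn leq_mul2r c_lt orbT.
Qed.

Lemma eq_good_record g g' c :
  (forall j, record_address c <= j < record_address c + S -> g j = g' j) ->
  good_record g c -> good_record g' c.
Proof.
move=> eq_g [gp gc]; have := size_stored_carol c => size_le; split.
  by apply: eq_path_gap gp => k k_lt; apply: eq_g; lia.
by move=> j j_lt; rewrite -gc // eq_g //; lia.
Qed.

Lemma positions_fromS c k : k < n -> positions_from c k =
  if matches c k.+1 then rcons (positions_from c k.+1) k.+1
  else positions_from c k.+1.
Proof.
move=> k_lt; rewrite /positions_from -(subnSK k_lt) /= rev_cons filter_rcons.
by [].
Qed.

Definition element_time := 100 * (5 + ca + cb + tc) + ta + cm.

Lemma reach_build_element c p cur g : c < Q -> 0 < p <= n -> p < cur <= n.+1 ->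
  let g1 := put_bits g (record_address c + N * 2) (stored_carol c) in
  reach build_element
    (Conf (regs c 0 (record_address c) 0 0 0 0 cur p 0 false) g None [::])
    element_time
    (Conf (regs c 0 (record_address c) 0 0 0 0
             (if matches c p then p else cur) p.-1 0 false)
       (if matches c p then store_gap N g1 (record_address c) cur p else g1)
       None [::]).
Proof.
move=> c_lt p_le cur_lt g1; have bs_le := record_address_le c_lt.
set bs := record_address c in bs_le *.
have Q_le : Q <= Q * S by rewrite leq_pmulr //; lia.
have ca_lt : ca < 2 ^ ca by exact: ltn_expl.
have cm_lt : cm < 2 ^ cm by exact: ltn_expl.
have ca_le : 2 ^ (ca + cm) <= Q by rewrite leq_exp2l //; lia.
have cacm_lt : ca + cm < 2 ^ (ca + cm) by exact: ltn_expl.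
have a_le := leq_div c (2 ^ cm); have b_le := leq_div c (2 ^ (ca + cm)).
have Dp : onth D p.-1 = Some (nth x0 D p.-1) by rewrite onthE (nth_map x0) //; lia.
have /(_ (c %/ 2 ^ cm) (c %/ 2 ^ (ca + cm)) 0 true g) :=
  build_walk (advice_of_word pi c) (c := c) (cur := cur) (p := p) (t := tree pi) Dp bs_le.
rewrite add0n addn0 => -[//||a' [b' [j' walk]]]; first lia.
have p1_lt : p.-1 < n by lia.
have x_in := mem_nth x0 p1_lt; have := alice_time_le (advice_of_word pi c) x_in => at_le.
eapply reach_le.
  asg; asg; asg; asg.
  eapply reach_seq; first exact: reach_start.
  rewrite /= subn1; eapply reach_seq; first exact: reach_turn.
  eapply reach_seq; first exact: walk.
  rewrite -/(matches c p) -/(stored_carol c) /= -/g1.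
  asg; asg; asg.
  eapply reach_seq.
    (* 60 steps for [emit] and one for the [If]; the configuration is given explicitly so that both
       branches end in the same one. *)
    instantiate (2 := 61).
    instantiate (1 := Conf (regs c 0 bs 0 0 0 0 (if matches c p then p else cur)
      p p.-1 (matches c p)) (if matches c p then store_gap N g1 bs cur p else g1) None [::]).
    apply: reach_if => //=; case: (matches c p) => /=.
      by apply: (reach_emit (ok := true)).
    by eapply reach_le; [apply: reach_skip | ].
  have m_lt : matches c p < 2 ^ w by case: (matches c p); lia.
  have c_lt' : (if matches c p then p else cur) < 2 ^ w by case: (matches c p); lia.
  asg; asg; eapply reach_post; first asg_last.
  by rewrite /= subn1; exact: reach_skip.
rewrite /= /element_time.
move: (bits_sent Alice _) (bits_sent Bob _) (carol_time _ _ _ _) (alice_time _ _ _ _)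
  alice_bits bob_bits carol_time_le at_le => {walk} A B C T *; lia.
Qed.

(** The loop invariant once the positions above [p] are treated. Clear marks up to [cur] are what
    the next [emit] requires. Carol's bits are present only after at least one element has been
    walked, hence the condition [p < n]. *)
Record building (g : nat -> bool) c p cur : Prop := Building {
  building_path : path (gap N g (record_address c)) n.+1 (positions_from c p);
  building_last : last n.+1 (positions_from c p) = cur;
  building_marks : forall k, k <= cur -> g (record_address c + N + k) = false;
  building_carol : p < n -> has_carol g c
}.

Lemma building_cur g c p cur : p <= n -> building g c p cur -> p < cur <= n.+1.
Proof.
move=> p_le [gp <- _ _]; rewrite (path_gap_last_le gp) andbT.
have : last n.+1 (positions_from c p) \in n.+1 :: positions_from c p by exact: mem_last.
rewrite inE => /predU1P[->|]; first by rewrite ltnS.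
by rewrite mem_filter mem_rev mem_iota => /andP[_ /andP[]].
Qed.

Lemma building_step g c p cur : 0 < p <= n -> building g c p cur ->
  let g1 := put_bits g (record_address c + N * 2) (stored_carol c) in
  building (if matches c p then store_gap N g1 (record_address c) cur p else g1)
    c p.-1 (if matches c p then p else cur).
Proof.
move=> /andP[p_gt0 p_le] bg; have cur_lt := building_cur p_le bg.
case: bg => gp gl gm gc g1; set bs := record_address c in gp gm *.
have size_le := size_stored_carol c.
have g1_low j : j < bs + N * 2 -> g1 j = g j.
  by move=> j_lt; rewrite /g1 /put_bits; case: ifP => //; rewrite -/bs; lia.
have carol1 : has_carol g1 c.
  move=> j j_lt; rewrite /g1 /put_bits; case: ifP => [_|]; last lia.
  by congr nth; lia.
have path1 : path (gap N g1 bs) n.+1 (positions_from c p).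
  by apply: eq_path_gap gp => k k_lt; rewrite g1_low //; lia.
have marks1 k : k <= cur -> g1 (bs + N + k) = false.
  by move=> k_le; rewrite g1_low ?gm //; lia.
have pp : p.-1.+1 = p by rewrite prednK.
have p1_lt : p.-1 < n by rewrite pp.
have := positions_fromS c p1_lt; rewrite pp => posE.
have curN : p < cur < N by lia.
split; rewrite ?posE; case: ifP => // _.
- rewrite rcons_path gl; apply/andP; split; last by apply: gap_store.
  apply: eq_path_gap path1 => k; rewrite gl => k_lt; rewrite store_gap_out //; lia.
- by rewrite last_rcons.
- by move=> k k_le; rewrite store_gap_out ?marks1 //; lia.
- by move=> _ j j_lt; rewrite store_gap_out ?carol1 //; rewrite -/bs; lia.
Qed.

Lemma reach_build_elements c p cur g : c < Q -> p <= n -> building g c p cur ->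
  exists g' cur',
  [/\ reach (While rp build_element)
        (Conf (regs c 0 (record_address c) 0 0 0 0 cur p 0 false) g None [::])
        (p * element_time.+1 + 1)
        (Conf (regs c 0 (record_address c) 0 0 0 0 cur' 0 0 false) g' None [::]),
      building g' c 0 cur'
    & forall j, ~~ (record_address c <= j < record_address c + S) -> g' j = g j].
Proof.
move=> c_lt; elim: p cur g => [|p IH] cur g p_le bg.
  by exists g, cur; split=> //; exact: reach_while_stop.
have cur_lt := building_cur p_le bg; have bg1 := building_step (p := p.+1) p_le bg.
cbv zeta in bg1; set g1 := (if _ then store_gap _ _ _ _ _ else _) in bg1.
have [g' [cur' [re bg' out]]] := IH _ _ (ltnW p_le) bg1.
exists g', cur'; split=> //.
  eapply reach_le.
    eapply reach_while_loop; [done | done | | exact: re].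
    by apply: reach_build_element.
  by rewrite mulSn; lia.
have size_le := size_stored_carol c.
move=> j j_out; rewrite out // /g1.
have put_out : put_bits g (record_address c + N * 2) (stored_carol c) j = g j.
  by rewrite /put_bits; case: ifP => //; lia.
by case: ifP => // _; rewrite store_gap_out //; lia.
Qed.

Definition record_time := n * element_time.+1 + 150.

Lemma reach_build_record c g : c < Q ->
  (forall k, k < n + 2 -> g (record_address c + N + k) = false) ->
  exists g',
  [/\ reach build_record (Conf (regs c.+1 0 0 0 0 0 0 0 0 0 false) g None [::])
        record_time (Conf (regs c 0 0 0 0 0 0 0 0 0 false) g' None [::]),
      good_record g' c
    & forall j, ~~ (record_address c <= j < record_address c + S) -> g' j = g j].
Proof.
move=> c_lt g0; have bs_le := record_address_le c_lt.
have pos_n : positions_from c n = [::] by rewrite /positions_from subnn.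
have [||g' [cur' [re bg out]]] := reach_build_elements (p := n) (cur := n.+1) (g := g) c_lt.
- by [].
- by split=> //; rewrite ?pos_n ?ltnn // => k k_le; apply: g0; lia.
have cur_lt := building_cur (leq0n _) bg.
exists (store_gap N g' (record_address c) cur' 0); split.
- have Q_le : Q <= Q * S by rewrite leq_pmulr //; lia.
  have cS_le : c.+1 * S <= Q * S by rewrite leq_mul2r c_lt orbT.
  have cSE : c.+1 * S = c * S + S by rewrite mulSn addnC.
  have c_le : c <= c * S by rewrite leq_pmulr //; lia.
  eapply reach_le.
    asg; rewrite subn1 /=; asg; rewrite -/(record_address c).
    asg; asg; rewrite addn1.
    eapply reach_seq; first exact: re.
    eapply reach_seq; first by apply: (reach_emit (ok := false)).
    by rewrite /=; asg; asg_last.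
  by rewrite /= /record_time; lia.
- have cur0 : 0 < cur' < N by lia.
  have size_le := size_stored_carol c.
  case: bg => gp gl gm gc; split.
    rewrite rcons_path gl; apply/andP; split; last by apply: gap_store.
    by apply: eq_path_gap gp => k; rewrite gl => k_lt; rewrite store_gap_out //; lia.
  by move=> j j_lt; rewrite store_gap_out ?gc //; lia.
- by move=> j j_out; rewrite store_gap_out ?out //; lia.
Qed.

(** Codes are treated downwards, so the memory below the records already built is still zero. This
    supplies the clear marks that the next record needs, and at the end a clear bitmap. *)
Lemma reach_build_records c g : c <= Q ->
  (forall j, j < record_address c -> g j = false) ->
  (forall c', c <= c' < Q -> good_record g c') ->
  exists g',
  [/\ reach (While rcode build_record)
        (Conf (regs c 0 0 0 0 0 0 0 0 0 false) g None [::])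
        (c * record_time.+1 + 1)
        (Conf (regs 0 0 0 0 0 0 0 0 0 0 false) g' None [::]),
      forall j, j < N -> g' j = false
    & forall c', c' < Q -> good_record g' c'].
Proof.
elim: c g => [|c IH] g c_lt g0 good.
  exists g; split=> // [|j j_lt]; first exact: reach_while_stop.
  by apply: g0; rewrite /record_address; lia.
have addrS := record_address_lt (ltnSn c).
have [|g1 [re1 good1 out1]] := reach_build_record c_lt (g := g).
  by move=> k k_lt; apply: g0; lia.
have [||g' [re g'0 good']] := IH g1 (ltnW c_lt).
- by move=> j j_lt; rewrite out1 ?g0 //; lia.
- move=> c'; rewrite leq_eqVlt => /andP[/predU1P[<- //|c'_gt] c'_lt].
  have addr_lt := record_address_lt c'_gt.
  apply: eq_good_record (good c' _); last by rewrite c'_gt.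
  by move=> j j_in; rewrite out1 //; lia.
exists g'; split=> //; eapply reach_le.
  by eapply reach_while_loop; [done | done | exact: re1 | exact: re].
by rewrite mulSn; lia.
Qed.

Lemma preprocessP :
  exists g',
  [/\ reach preprocess
        (Conf [:: n; ca; cb; cc; cm; 0; 0; 0; 0; 0; 0; 0; 0; 0; 0; 0] (fun=> false) None [::])
        (Q * record_time.+1 + 20) (Conf (regs 0 0 0 0 0 0 0 0 0 0 false) g' None [::]),
      forall j, j < N -> g' j = false
    & forall c', c' < Q -> good_record g' c'].
Proof.
have [|c'|g' [re g'0 good]] := reach_build_records (g := fun=> false) (leqnn Q).
- by [].
- by rewrite leqNgt => /andP[/negbTE->].
exists g'; split=> //.
have Q_le : Q <= Q * S by rewrite leq_pmulr //; lia.
have lt_Q : ca + cb + cm < Q by exact: ltn_expl.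
eapply reach_le.
  asg; rewrite mul1n; exact: re.
by rewrite /=; lia.
Qed.

End Preprocessing.

(** * Surplus high bits of a code are harmless *)

Section HighBits.
Local Open Scope nat_scope.
Variables (R : realFieldType) (X : choiceType) (Y : Type).
Variables (Rpub Rpri : choiceType) (cm : nat).
Variables (lam : dist R X) (rpub : Rpub) (rpri : Rpri).
Local Notation tree_t := (ptree R X Y Rpub Rpri cm).
Implicit Types (t : tree_t) (m : advice cm).

Lemma half_add_exp a e k : (a + e * 2 ^ k.+1)./2 = a./2 + e * 2 ^ k.
Proof. by rewrite expnS mulnCA mul2n halfD odd_double andbF doubleK. Qed.

Lemma odd_add_exp a e k : odd (a + e * 2 ^ k.+1) = odd a.
Proof. by rewrite expnS mulnCA mul2n oddD odd_double addbF. Qed.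

(** Each message of Alice consumes one bit of her guess, so bits from position [k] on are never
    reached. It is applied with Bob's guess as [e]. *)
Lemma carol_bits_high t a b e k : bits_sent Alice t <= k ->
  carol_bits lam rpub rpri t (a + e * 2 ^ k) b = carol_bits lam rpub rpri t a b.
Proof.
elim: t a b k => [o st|msg st t0 IH0 t1 IH1|msg st t0 IH0 t1 IH1|msg st t0 IH0 t1 IH1]
  a b k //=.
- case: k => // k; rewrite add1n ltnS geq_max => /andP[le0 le1].
  by rewrite half_add_exp odd_add_exp; case: ifP => _; [exact: IH1 | exact: IH0].
- by rewrite add0n geq_max => /andP[le0 le1]; case: ifP => _; [exact: IH1 | exact: IH0].
- rewrite add0n geq_max => /andP[le0 le1]; congr cons.
  by case: ifP => _; [exact: IH1 | exact: IH0].
Qed.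

Lemma follows_high x m t a b e k : bits_sent Alice t <= k ->
  follows lam rpub rpri x m t (a + e * 2 ^ k) b = follows lam rpub rpri x m t a b.
Proof.
elim: t a b k => [o st|msg st t0 IH0 t1 IH1|msg st t0 IH0 t1 IH1|msg st t0 IH0 t1 IH1]
  a b k //=.
- case: k => // k; rewrite add1n ltnS geq_max => /andP[le0 le1].
  rewrite half_add_exp odd_add_exp; congr andb.
  by case: ifP => _; [exact: IH1 | exact: IH0].
- by rewrite add0n geq_max => /andP[le0 le1]; case: ifP => _; [exact: IH1 | exact: IH0].
- by rewrite add0n geq_max => /andP[le0 le1]; case: ifP => _; [exact: IH1 | exact: IH0].
Qed.

Lemma leafP y m t a :
  exists out st, [/\ leaf lam rpub rpri y m t a = Output _ _ _ _ out st,
    out y m = bob_output lam rpub rpri y m t a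
    & bob_time y m (leaf lam rpub rpri y m t a) = (st y m).+1].
Proof.
elim: t a => [o st|msg st t0 IH0 t1 IH1|msg st t0 IH0 t1 IH1|msg st t0 IH0 t1 IH1] a /=.
- by exists o, st.
- by case: ifP.
- by case: ifP.
- by case: ifP.
Qed.

End HighBits.

Lemma advice_of_word_high (R : realFieldType) (X : choiceType) (Y : Type)
    (pi : protocol R X Y) (q e : nat) :
  advice_of_word pi (q + e * 2 ^ advice_len pi)%N = advice_of_word pi q.
Proof.
apply/eq_from_tnth => i; rewrite !tnth_mktuple.
(* The added number is a multiple of 2 ^ (i + 1), so it leaves bit [i] alone. *)
have -> : (e * 2 ^ advice_len pi = e * 2 ^ (advice_len pi - i.+1) * 2 * 2 ^ i)%N.
  by rewrite -!mulnA -expnS -expnD subnK.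
by rewrite divnDMl ?expn_gt0 // oddD oddM andbF addbF.
Qed.

(** * Correctness and time of a query *)

Section Querying.
Local Open Scope nat_scope.
Variables (R : realFieldType) (X : choiceType) (Y : Type).
Variables (f : X -> Y -> bool) (pi : protocol R X Y) (D : seq X).
Variables (lam : dist R X) (w space : nat).
Variables (ca cb cc : nat) (rpub : Rpub pi) (rpri : Rpri pi) (y : Y).
Local Notation n := (size D).
Local Notation cm := (advice_len pi).
Local Notation N := (n + 2).
Local Notation S := (N * 2 + cc).
Local Notation Q := (2 ^ (ca + cb + cm)).
Hypothesis space_ge : N + Q * S <= space.
Hypothesis space_le : space <= 2 ^ w.
Variables (x0 : X).
Hypothesis alice_bits : bits_sent Alice (tree pi) <= ca.
Hypothesis bob_bits : bits_sent Bob (tree pi) <= cb.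
Hypothesis carol_bits_le : bits_sent Carol (tree pi) <= cc.
Variable g0 : nat -> bool.
Hypothesis g0_good :
  forall c, c < Q -> good_record D lam ca cc rpub rpri x0 g0 c.

Local Notation record_address := (record_address D cc).
Local Notation reach := (reach f D lam w space (Query pi y)).
Local Notation regs q a bs wt j t u cur z i gp :=
  [:: n; ca; cb; cc; cm; q; a; bs; wt; j; t; u; cur; z; i; gp].

(** The memory during a query: only the bitmap in the first [N] bits ever differs from the
    preprocessed memory [g0]. *)
Definition marked (marks : seq nat) : nat -> bool :=
  fun j => if j < N then j \in marks else g0 j.

Definition listed q b := [seq p <- rev (iota 1 n) |
  follows lam rpub rpri (nth x0 D p.-1) (advice_of_word pi q) (tree pi) (q %/ 2 ^ cm) b].

Lemma code_lt q b : q < 2 ^ (ca + cm) -> b < 2 ^ cb -> q + b * 2 ^ (ca + cm) < Q.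
Proof.
move=> q_lt b_lt; apply: leq_trans (_ : b.+1 * 2 ^ (ca + cm) <= _).
  by rewrite mulSn ltn_add2r.
have -> : ca + cb + cm = cb + (ca + cm) by lia.
by rewrite [in X in _ <= X]expnD leq_mul2r b_lt orbT.
Qed.

Lemma code_bob q b : q < 2 ^ (ca + cm) -> (q + b * 2 ^ (ca + cm)) %/ 2 ^ (ca + cm) = b.
Proof. by move=> q_lt; rewrite divnDMl ?expn_gt0 // divn_small. Qed.

Lemma code_alice q b :
  (q + b * 2 ^ (ca + cm)) %/ 2 ^ cm = q %/ 2 ^ cm + b * 2 ^ ca.
Proof. by rewrite [in LHS]expnD mulnA divnDMl ?expn_gt0. Qed.

Lemma positions_listed q b : q < 2 ^ (ca + cm) ->
  positions_from D lam ca rpub rpri x0 (q + b * 2 ^ (ca + cm)) 0 = listed q b.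
Proof.
move=> q_lt; rewrite /positions_from subn0; apply: eq_filter => p.
rewrite /matches code_bob // code_alice follows_high //.
by rewrite expnD mulnA advice_of_word_high.
Qed.

Lemma g0_carol q b j : q < 2 ^ (ca + cm) -> b < 2 ^ cb ->
  let bits := carol_bits lam rpub rpri (tree pi) (q %/ 2 ^ cm) b in
  j < size bits ->
  g0 (record_address (q + b * 2 ^ (ca + cm)) + N * 2 + j) = nth false bits j.
Proof.
move=> q_lt b_lt bits; have [_ /(_ j)] := g0_good (code_lt q_lt b_lt).
by rewrite /stored_carol code_bob // code_alice carol_bits_high //; apply.
Qed.

Lemma reach_ask_bob r l g m msg st t0 t1 rep :
  reach (Do (AskBob r)) (Conf l g (Some (m, BSend msg st t0 t1)) rep)
    (st y m).+1
    (Conf (set_nth 0 l r (msg y m)) g (Some (m, BSend msg st t0 t1)) rep).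
Proof.
apply: reach_step => s sc.
have [sa sn] := agree_sim sc; rewrite /= sn /= sa.
by eexists _, _; split; [reflexivity | by [] | apply: agree_set_reg].
Qed.

Lemma reach_ask_output r l g m msg st rep :
  reach (Do (AskBob r)) (Conf l g (Some (m, Output _ _ _ _ msg st)) rep)
    (st y m).+1
    (Conf (set_nth 0 l r (msg y m)) g None rep).
Proof.
apply: reach_step => s sc.
have [sa sn] := agree_sim sc; rewrite /= sn /= sa.
eexists _, _; split; [reflexivity | by [] | ].
by case: (agree_set_reg r (msg y m) sc); split.
Qed.

Lemma reach_test r i l g sim rep x : i < nvars -> onth D (nth 0 l i) = Some x ->
  reach (Do (Test r i)) (Conf l g sim rep) 1
    (Conf (set_nth 0 l r (f x y)) g sim rep).
Proof.
move=> i_lt Di; apply: reach_step => s sc; rewrite /= (agree_reg sc i_lt) /= Di.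
by eexists _, _; split; [reflexivity | by [] | apply: agree_set_reg].
Qed.

Lemma reach_report i l g sim rep x : i < nvars -> onth D (nth 0 l i) = Some x ->
  reach (Do (Report i)) (Conf l g sim rep) 1 (Conf l g sim (rcons rep x)).
Proof.
move=> i_lt Di; apply: reach_step => s sc; rewrite /= (agree_reg sc i_lt) /= Di.
eexists _, _; split; [reflexivity | by [] | ].
by case: sc => *; split=> //=; congr rcons.
Qed.

Ltac fit := rewrite /fits /=; lia.
Ltac asg := eapply reach_seq; [eapply reach_assign; [done|done|fit] | simpl].
Ltac asg_last := eapply reach_assign; [done|done|fit].

(** Bit [k] of Bob has weight 2 ^ (ca + cm + k) in the code, and consecutive codes are [S] bits
    apart. *)
Lemma record_weight q b (u : bool) k :
  record_address (q + b * 2 ^ (ca + cm)) + u * (S * 2 ^ (ca + cm + k)) =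
  record_address (q + (b + u * 2 ^ k) * 2 ^ (ca + cm)).
Proof.
rewrite /record_address (expnD 2 (ca + cm) k); move: (2 ^ (ca + cm)) (2 ^ k) => A B.
by case: u; lia.
Qed.

(** [b] collects the first [k] bits of Bob, [pre] the bits of Carol already read. The last
    hypothesis says that every extension of [b] yields [pre] followed by the bits of the current
    subtree, so any record extending [b] may be read. The time of the leaf stands on the left so
    that Bob's output, asked after the loop, is still covered by [bob_time y m t]. *)
Definition query_walk_spec q marks rep m t := forall a b j k pre,
  k + bits_sent Bob t <= cb -> j + bits_sent Carol t <= cc ->
  a <= q -> b < 2 ^ k -> size pre = j ->
  (forall b', carol_bits lam rpub rpri (tree pi) (q %/ 2 ^ cm) (b + b' * 2 ^ k) =
     pre ++ carol_bits lam rpub rpri t a b') ->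
  exists wt' j' T,
  reach (While rturn query_step)
    (Conf (regs q a (record_address (q + b * 2 ^ (ca + cm))) (S * 2 ^ (ca + cm + k)) j
             (turn_code t) 0 0 0 0 0) (marked marks) (Some (m, t)) rep)
    T
    (Conf (regs q (rest lam rpub rpri y m t a)
             (record_address
                (q + (b + bob_code lam rpub rpri y m t a * 2 ^ k) * 2 ^ (ca + cm)))
             wt' j' 0 0 0 0 0 0) (marked marks)
       (Some (m, leaf lam rpub rpri y m t a)) rep) /\
  T + bob_time y m (leaf lam rpub rpri y m t a) <=
    100 * (1 + bits_sent Alice t + bits_sent Bob t + bits_sent Carol t) + bob_time y m t.

Lemma query_walk q marks rep m t : q < 2 ^ (ca + cm) ->
  query_walk_spec q marks rep m t.
Proof.
move=> q_lt; have w_gt0 : 0 < w by case: (w) space_le => //; lia.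
have ca_le : 2 ^ (ca + cm) <= Q by rewrite leq_exp2l //; lia.
have Q_le : Q <= Q * S by rewrite leq_pmulr //; lia.
elim: t => [o st|msg st t0 IH0 t1 IH1|msg st t0 IH0 t1 IH1|msg st t0 IH0 t1 IH1]
  a b j k pre k_le j_le a_le b_lt size_pre carolE.
- eexists _, _, 1; split; last by rewrite /=; lia.
  by rewrite /= mul0n addn0; exact: reach_while_stop.
- have : query_walk_spec q marks rep m (if odd a then t1 else t0) by case: ifP.
  have le_A := bits_sent_if Alice t0 t1 (odd a).
  have le_B := bits_sent_if Bob t0 t1 (odd a).
  have le_C := bits_sent_if Carol t0 t1 (odd a).
  rewrite /= in k_le j_le.
  move/(_ a./2 b j k pre) => -[||||||wt' [j' [T [IH T_le]]]]; try lia; try done.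
  eexists wt', j', _; split.
    rewrite /=; eapply reach_while_loop; [done | done | | exact: IH].
    eapply reach_seq.
      eapply reach_cond; [done | fit | simpl].
      asg; asg_last.
    rewrite /= modn2 divn2.
    eapply reach_post; first by apply: reach_advance => //=; case: (odd a).
    by rewrite /= eqb1; exact: reach_skip.
  rewrite /=; have : bob_time y m (if odd a then t1 else t0) <=
     maxn (bob_time y m t0) (bob_time y m t1) by case: ifP; lia.
  by lia.
- pose u := msg y m.
  have : query_walk_spec q marks rep m (if u then t1 else t0) by case: ifP.
  have le_A := bits_sent_if Alice t0 t1 u.
  have le_B := bits_sent_if Bob t0 t1 u.
  have le_C := bits_sent_if Carol t0 t1 u.
  rewrite /= in k_le j_le.
  have bu_lt : b + u * 2 ^ k < 2 ^ k.+1 by rewrite expnS; case: (u); lia.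
  move/(_ a (b + u * 2 ^ k) j k.+1 pre) => -[||||||wt' [j' [T [IH T_le]]]]; try lia; try done.
    move=> b'; have -> : b + u * 2 ^ k + b' * 2 ^ k.+1 = b + (u + b'.*2) * 2 ^ k.
      by rewrite expnS; lia.
    by rewrite carolE /= oddD odd_double addbF oddb half_bit_double.
  have u_lt : u < 2 ^ w by case: (u); lia.
  have b_lt' : b < 2 ^ cb by apply: leq_trans b_lt _; rewrite leq_exp2l //; lia.
  have bu_lt' : b + u * 2 ^ k < 2 ^ cb.
    by apply: leq_trans bu_lt _; rewrite leq_exp2l //; lia.
  have addr_le := record_address_le space_ge (code_lt q_lt b_lt').
  have := record_address_le space_ge (code_lt q_lt bu_lt').
  rewrite -record_weight => addr_le'.
  have wt_le : S * 2 ^ (ca + cm + k.+1) <= Q * S.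
    by rewrite mulnC leq_mul2r leq_exp2l //; lia.
  have wtE : S * 2 ^ (ca + cm + k.+1) = S * 2 ^ (ca + cm + k) * 2.
    by rewrite (addnS (ca + cm)) expnS; lia.
  eexists wt', j', _; split.
    rewrite /=; eapply reach_while_loop; [done | done | | ]; last first.
      eapply reach_post; first exact: IH.
      rewrite (_ : b + u * 2 ^ k + _ * 2 ^ k.+1 = b + (u +
        (bob_code lam rpub rpri y m (if u then t1 else t0) a).*2) * 2 ^ k) -/u.
        exact: reach_skip.
      by rewrite expnS; lia.
    eapply reach_seq.
      eapply reach_cond; [done | fit | simpl].
      eapply reach_cond; [done | fit | simpl].
      eapply reach_seq; first exact: reach_ask_bob.
      rewrite /= -/u; asg; asg_last.
    rewrite /= record_weight -wtE.
    eapply reach_post; first by apply: reach_advance => //=; case: (u).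
    by rewrite /= eqb1; exact: reach_skip.
  rewrite /= -/u.
  by case: (u) le_A le_B le_C T_le => /=; lia.
- pose u := msg lam rpub rpri.
  have : query_walk_spec q marks rep m (if u then t1 else t0) by case: ifP.
  have le_A := bits_sent_if Alice t0 t1 u.
  have le_B := bits_sent_if Bob t0 t1 u.
  have le_C := bits_sent_if Carol t0 t1 u.
  rewrite /= in k_le j_le.
  move/(_ a b j.+1 k (rcons pre u)) => -[||||||wt' [j' [T [IH T_le]]]]; try lia; try done.
  - by rewrite size_rcons size_pre.
  - by move=> b'; rewrite carolE /= cat_rcons.
  have b_lt' : b < 2 ^ cb by apply: leq_trans b_lt _; rewrite leq_exp2l //; lia.
  have addr_le := record_address_le space_ge (code_lt q_lt b_lt').
  (* The current record is the extension of [b] by zeros, that is [carolE] at 0, and it lies above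
     the bitmap. *)
  have stored : marked marks (record_address (q + b * 2 ^ (ca + cm)) + N * 2 + j) = u.
    rewrite /marked; case: ifP; first by rewrite /record_address; lia.
    move=> _; rewrite g0_carol //; have := carolE 0; rewrite mul0n addn0 => ->.
      by rewrite nth_cat size_pre ltnn subnn.
    by rewrite size_cat size_pre /= addnS ltnS leq_addr.
  eexists wt', j', _; split.
    rewrite /=; eapply reach_while_loop; [done | done | | exact: IH].
    eapply reach_seq.
      eapply reach_cond; [done | fit | simpl].
      eapply reach_cond; [done | fit | simpl].
      eapply reach_seq.
        eapply reach_load; [done | done | done | fit | fit | rewrite /=; lia | rewrite /=; lia].
      rewrite /= load_field1 stored; asg_last.
    rewrite /= addn1.
    eapply reach_post; first by apply: reach_advance => //=; case: (u).
    by rewrite /= eqb1; exact: reach_skip.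
  rewrite /=; have : bob_time y m (if u then t1 else t0) <=
     maxn (bob_time y m t0) (bob_time y m t1) by case: ifP; lia.
  by lia.
Qed.

(** A gap is at most n + 1, so its mark lies in the window, at offset L - z, and nothing above it is
    marked. What lies below belongs to later entries or even to the gap fields, but cannot affect
    the most significant bit. *)
Lemma trunc_log_window g bs h p : h <= n.+1 -> gap N g bs h p ->
  trunc_log 2 n.+1 -
    trunc_log 2 (load_field g (bs + N + h - trunc_log 2 n.+1) (trunc_log 2 n.+1).+1)
  = trunc_log 2 (h - p).
Proof.
rewrite /gap; set L := trunc_log 2 n.+1; set z := trunc_log 2 (h - p).
move=> h_le /and4P[ph _ mark /allP unmarked].
have L_lt : L < n.+1 by apply: trunc_log_lt.
have z_le : z <= L by apply: leq_trunc_log; lia.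
rewrite load_fieldE (@trunc_log_bits_value _ _ (L - z)); first lia.
- lia.
- by have -> : bs + N + h - L + (L - z) = bs + N + h - z by lia.
- move=> j j_lt; have -> : bs + N + h - L + j = bs + N + h - (L - j) by lia.
  by apply: unmarked; rewrite mem_iota; lia.
Qed.

Lemma reach_next q bs h p g sim rep :
  bs + S <= space -> h <= n.+1 -> gap N g bs h p ->
  reach next_entry (Conf (regs q 0 bs 0 0 0 0 h 0 0 0) g sim rep) 60
    (Conf (regs q 0 bs 0 0 0 0 p 0 0 0) g sim rep).
Proof.
move=> bs_le h_le hp; have zE := trunc_log_window h_le hp.
have lt_ph := gap_lt hp.
have ld : load_field g (bs + h - trunc_log 2 (h - p)) (trunc_log 2 (h - p)).+1 = h - p.
  by case/and4P: hp => _ /eqP.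
have z_lt : trunc_log 2 (h - p) < h - p by apply: trunc_log_lt; lia.
have L_lt : trunc_log 2 n.+1 < n.+1 by apply: trunc_log_lt.
have L_w : trunc_log 2 n.+1 < w by apply: trunc_log_le_w space_ge space_le _ _.
have z_w : trunc_log 2 (h - p) < w.
  by apply: trunc_log_le_w space_ge space_le _ _; lia.
have w_lt : w < 2 ^ w := ltn_expl w (ltnSn 1).
pose v := load_field g (bs + N + h - trunc_log 2 n.+1) (trunc_log 2 n.+1).+1.
have v_ltL : v < 2 ^ (trunc_log 2 n.+1).+1 by rewrite /v load_fieldE bits_value_lt.
have v_lt : v < 2 ^ w by apply: leq_trans v_ltL _; rewrite leq_exp2l.
have v_log : trunc_log 2 v <= trunc_log 2 n.+1.
  have [->|v_gt0] := posnP v; first by rewrite trunc_log0.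
  rewrite -ltnS -(ltn_exp2l (m := 2)) //.
  by apply: leq_ltn_trans (trunc_logP _ v_gt0) v_ltL.
rewrite -/v in zE; eapply reach_le.
  eapply reach_seq.
    eapply reach_load; [done|done|done|rewrite /= !addn1; lia|rewrite /= !addn1; lia
      |rewrite /= !addn1; lia|rewrite /= !addn1; lia].
  rewrite /= !addn1 -/v; eapply reach_seq.
    eapply reach_assign; [done | done | rewrite /fits /= !addn1; lia].
  rewrite /= addn1 zE.
  eapply reach_seq.
    eapply reach_load; [done|done|done|fit|fit|rewrite /=; lia|rewrite /=; lia].
  rewrite /= addn1 ld; asg; asg; eapply reach_post; first asg_last.
  by rewrite /= subKn ?(ltnW lt_ph) //; exact: reach_skip.
by [].
Qed.

Section Pass.
(** Both passes are verified at once: [V] is the effect of [visit] on the pair of marked positions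
    and reported elements, and a pass folds it over the positions met. *)
Variables (visit : prog) (V : seq nat * seq X -> nat -> seq nat * seq X).
Hypothesis visitP : forall q bs p st, 0 < p <= n ->
  reach visit (Conf (regs q 0 bs 0 0 0 0 p 0 0 0) (marked st.1) None st.2) 80
    (Conf (regs q 0 bs 0 0 0 0 p 0 0 0) (marked (V st p).1) None (V st p).2).

Lemma reach_query_list_loop q bs h ps st :
  bs + S <= space -> N <= bs -> h <= n.+1 -> all (fun p => 0 < p <= n) ps ->
  path (gap N g0 bs) h (rcons ps 0) ->
  reach (While rcur (visit;; next_entry)%prog)
    (Conf (regs q 0 bs 0 0 0 0 (head 0 (rcons ps 0)) 0 0 0) (marked st.1) None st.2)
    (150 * size ps + 1)
    (Conf (regs q 0 bs 0 0 0 0 0 0 0 0) (marked (foldl V st ps).1) None (foldl V st ps).2).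
Proof.
move=> bs_le N_le; elim: ps h st => [|p ps IH] h st h_le /=.
  by move=> _ _; exact: reach_while_stop.
move=> /andP[p_le ps_le] /andP[_ ps_path].
have p_le' : p <= n.+1 by lia.
have p0 : p != 0 by lia.
eapply reach_le.
  eapply reach_while_loop; [done | exact: p0 | | exact: (IH p (V st p))].
  eapply reach_seq; first exact: visitP.
  apply: reach_next => //.
  have : gap N g0 bs p (head 0 (rcons ps 0)) by case: (ps) ps_path => /= [|? ?] /andP[].
  by apply: eq_gap => k _; rewrite /marked; case: ifP => //; lia.
by rewrite mulnS; lia.
Qed.

Lemma reach_query_list q bs ps st :
  bs + S <= space -> N <= bs -> all (fun p => 0 < p <= n) ps ->
  path (gap N g0 bs) n.+1 (rcons ps 0) ->
  reach (query_list visit)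
    (Conf (regs q 0 bs 0 0 0 0 0 0 0 0) (marked st.1) None st.2)
    (150 * size ps + 70)
    (Conf (regs q 0 bs 0 0 0 0 0 0 0 0) (marked (foldl V st ps).1) None (foldl V st ps).2).
Proof.
move=> bs_le N_le ps_le ps_path; eapply reach_le.
  asg; rewrite addn1; eapply reach_seq; last exact: (reach_query_list_loop (h := n.+1)).
  apply: reach_next => //.
  have : gap N g0 bs n.+1 (head 0 (rcons ps 0)) by case: (ps) ps_path => /= [|? ?] /andP[].
  by apply: eq_gap => k _; rewrite /marked; case: ifP => //; lia.
by rewrite /=; lia.
Qed.

Definition found q : seq nat :=
  let m := advice_of_word pi q in
  let a := q %/ 2 ^ cm in
  if bob_output lam rpub rpri y m (tree pi) a && (rest lam rpub rpri y m (tree pi) a == 0)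
  then listed q (bob_code lam rpub rpri y m (tree pi) a) else [::].

Variable tb : nat.
Hypothesis bob_time_le : forall m, bob_time y m (tree pi) <= tb.

Definition code_time := 100 * (4 + ca + cb + cc) + tb + cm.

Lemma reach_query_code q st : q < 2 ^ (ca + cm) ->
  reach (query_code visit)
    (Conf (regs q.+1 0 0 0 0 0 0 0 0 0 0) (marked st.1) None st.2)
    (code_time + 150 * size (found q))
    (Conf (regs q 0 0 0 0 0 0 0 0 0 0) (marked (foldl V st (found q)).1) None
       (foldl V st (found q)).2).
Proof.
move=> q_lt; set m := advice_of_word pi q; set a := q %/ 2 ^ cm.
pose b := bob_code lam rpub rpri y m (tree pi) a.
have b_lt : b < 2 ^ cb.
  by apply: leq_trans (bob_code_lt _ _ _ _ _ _ _) _; rewrite leq_exp2l.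
have [||||||wt' [j' [T [walk T_le]]]] :=
  query_walk st.1 st.2 m (t := tree pi) q_lt (a := a) (b := 0) (j := 0) (k := 0) (pre := [::]).
- by rewrite add0n.
- by rewrite add0n.
- exact: leq_div.
- by [].
- by [].
- by move=> b'; rewrite add0n muln1.
have [out [st_out [leafE outE timeE]]] := leafP lam rpub rpri y m (tree pi) a.
rewrite mul0n !add0n muln1 !addn0 -/b leafE in walk.
have addr_le := record_address_le space_ge (code_lt q_lt b_lt).
(* The address at which the walk begins, before any bit of Bob is known. *)
have := record_address_le space_ge (code_lt (b := 0) q_lt _).
rewrite mul0n !addn0 expn_gt0 => /(_ isT) addr_le0.
have Q_le : Q <= Q * S by rewrite leq_pmulr //; lia.
have ca_le : 2 ^ (ca + cm) <= Q by rewrite leq_exp2l //; lia.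
have cacm_lt : ca + cm < 2 ^ (ca + cm) by exact: ltn_expl.
have q_le : q * S + S <= Q * S.
  by rewrite addnC -mulSn leq_mul2r (leq_trans q_lt) ?orbT.
have q_leS : q <= q * S by rewrite leq_pmulr //; lia.
have wt_le : S * 2 ^ (ca + cm) <= Q * S by rewrite mulnC leq_mul2r ca_le orbT.
have a_le : a <= q := leq_div _ _.
(* The walk leaves [rest] in [ra]; this bound makes it fit in a word. *)
have rest_le : rest lam rpub rpri y m (tree pi) a <= a.
  elim: (tree pi) (a) => [o s|ms s t0 IH0 t1 IH1|ms s t0 IH0 t1 IH1|ms s t0 IH0 t1 IH1] a' //=.
  - apply: leq_trans (_ : a'./2 <= _); first by case: ifP.
    by lia.
  - by case: ifP.
  - by case: ifP.
have listP : reach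
   (Cond $rbit (rbit ::= #0;; query_list visit) Skip)%prog
   (Conf (regs q 0 (record_address (q + b * 2 ^ (ca + cm))) 0 0 0
      (nat_of_bool (out y m && (rest lam rpub rpri y m (tree pi) a == 0))) 0 0 0 0)
      (marked st.1) None st.2)
   (150 * size (found q) + 80)
   (Conf (regs q 0 (record_address (q + b * 2 ^ (ca + cm))) 0 0 0 0 0 0 0 0)
      (marked (foldl V st (found q)).1) None (foldl V st (found q)).2).
  rewrite /found -/m -/a -/b outE; case: ifP => _ /=.
    eapply reach_le.
      eapply reach_cond; [done | fit | rewrite /=; asg].
      apply: reach_query_list.
      - exact: addr_le.
      - by rewrite /record_address; lia.
      - by apply/allP => p; rewrite mem_filter mem_rev mem_iota => /andP[_]; lia.
      - have [gp _] := g0_good (code_lt q_lt b_lt).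
        by rewrite positions_listed in gp.
    by rewrite /=; lia.
  eapply reach_le.
    eapply reach_cond; [done | fit | rewrite /=; exact: reach_skip].
  by [].
have out_lt (u v : bool) : u * v < 2 ^ w by case: u; case: v; lia.
eapply reach_le.
  asg; rewrite subn1 /=; asg; rewrite -/a.
  asg; rewrite -/(record_address q).
  asg.
  eapply reach_seq; first exact: reach_start.
  eapply reach_seq; first exact: reach_turn.
  rewrite /= -/m.
  eapply reach_seq; first exact: walk.
  asg; asg.
  eapply reach_seq; first exact: reach_ask_output.
  rewrite /=.
  asg.
  rewrite mulnb; asg; eapply reach_seq; first exact: listP.
  rewrite /=; asg; asg_last.
rewrite /= /code_time.
have := bob_time_le m; rewrite timeE in T_le; move: T_le alice_bits bob_bits carol_bits_le.
move: (bits_sent Alice _) (bits_sent Bob _) (bits_sent Carol _) (bob_time _ _ _).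
by move: (st_out y m) (size (found q)) => o F A B C *; lia.
Qed.

Definition found_below q := flatten [seq found k | k <- rev (iota 0 q)].

Lemma found_belowS q : found_below q.+1 = found q ++ found_below q.
Proof. by rewrite /found_below -addn1 iotaD rev_cat. Qed.

Lemma reach_query_codes q st : q <= 2 ^ (ca + cm) ->
  reach (While rcode (query_code visit))
    (Conf (regs q 0 0 0 0 0 0 0 0 0 0) (marked st.1) None st.2)
    (q * code_time.+1 + 150 * size (found_below q) + 1)
    (Conf (regs 0 0 0 0 0 0 0 0 0 0 0) (marked (foldl V st (found_below q)).1) None
       (foldl V st (found_below q)).2).
Proof.
elim: q st => [|q IH] st q_le; first by eapply reach_le; [exact: reach_while_stop | ].
rewrite found_belowS foldl_cat size_cat mulSn; eapply reach_le.
  eapply reach_while_loop; [done | done | exact: reach_query_code | ].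
  exact: IH (ltnW q_le).
lia.
Qed.

Lemma reach_query_pass st :
  reach (query_pass visit)
    (Conf (regs 0 0 0 0 0 0 0 0 0 0 0) (marked st.1) None st.2)
    (2 ^ (ca + cm) * code_time.+1 + 150 * size (found_below (2 ^ (ca + cm))) + 10)
    (Conf (regs 0 0 0 0 0 0 0 0 0 0 0)
       (marked (foldl V st (found_below (2 ^ (ca + cm)))).1) None
       (foldl V st (found_below (2 ^ (ca + cm)))).2).
Proof.
have Q_le : Q <= Q * S by rewrite leq_pmulr //; lia.
have ca_le : 2 ^ (ca + cm) <= Q by rewrite leq_exp2l //; lia.
have cacm_lt : ca + cm < 2 ^ (ca + cm) by exact: ltn_expl.
eapply reach_le.
  asg; rewrite mul1n; exact: reach_query_codes.
by rewrite /=; lia.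
Qed.

End Pass.

Definition report_visit (st : seq nat * seq X) p :=
  let x := nth x0 D p.-1 in
  if f x y && (p \notin st.1) then (rcons st.1 p, rcons st.2 x) else st.

Definition unmark_visit (st : seq nat * seq X) p := ([seq k <- st.1 | k != p], st.2).

Lemma reach_report_new q bs p st : 0 < p <= n ->
  reach report_new (Conf (regs q 0 bs 0 0 0 0 p 0 0 0) (marked st.1) None st.2) 80
    (Conf (regs q 0 bs 0 0 0 0 p 0 0 0)
       (marked (report_visit st p).1) None (report_visit st p).2).
Proof.
move=> p_le; have w_gt0 : 0 < w by case: (w) space_le => //; lia.
have Dp : onth D p.-1 = Some (nth x0 D p.-1) by rewrite onthE (nth_map x0) //; lia.
have N_le : N <= space by lia.
have markE : load_field (marked st.1) p 1 = (p \in st.1).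
  by rewrite load_field1 /marked; case: ifP => //; lia.
rewrite /report_visit; case p_in: (p \in st.1) markE => markE; rewrite ?andbF ?andbT.
  eapply reach_le.
    eapply reach_seq.
      eapply reach_load; [done|done|done|fit|fit|rewrite /=; lia|rewrite /=; lia].
    rewrite /= markE; eapply reach_seq.
      eapply reach_cond; [done | fit | rewrite /=; exact: reach_skip].
    by asg_last.
  by [].
have reportP : reach (If rbit (StoreBits $rcur #1 #1;; Do (Report ri)) Skip)%prog
    (Conf (regs q 0 bs 0 0 0 (nat_of_bool (f (nth x0 D p.-1) y)) p 0 p.-1 0)
       (marked st.1) None st.2) 20
    (let st' := if f (nth x0 D p.-1) y
       then (rcons st.1 p, rcons st.2 (nth x0 D p.-1)) else st in
     Conf (regs q 0 bs 0 0 0 (nat_of_bool (f (nth x0 D p.-1) y)) p 0 p.-1 0)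
       (marked st'.1) None st'.2).
  apply: reach_if => //=; case: (f _ y) => /=; last first.
    by eapply reach_le; [exact: reach_skip | ].
  eapply reach_le.
    eapply reach_seq.
      eapply reach_store; [done|done|done|fit|fit|fit|rewrite /=; lia|rewrite /=; lia].
    eapply reach_post; first (eapply reach_report; [done | exact: Dp]).
    apply: reach_skip => k; rewrite /= /store_field /marked mem_rcons inE.
    case: ifP => [k_p|k_p].
      have -> : k = p by lia.
      by rewrite subnn eqxx /=; case: ifP => //; lia.
    by case: (k =P p) => // kp; lia.
  by [].
cbv zeta in reportP; eapply reach_le.
  eapply reach_seq.
    eapply reach_load; [done|done|done|fit|fit|rewrite /=; lia|rewrite /=; lia].
  rewrite /= markE; eapply reach_seq.
    eapply reach_cond; [done | fit | rewrite /=].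
    asg; rewrite subn1.
    eapply reach_seq; first (eapply reach_test; [done | exact: Dp]).
    rewrite /=; eapply reach_seq; first exact: reportP.
    by asg_last.
  by rewrite /=; asg_last.
by [].
Qed.

Lemma reach_unmark q bs p st : 0 < p <= n ->
  reach unmark (Conf (regs q 0 bs 0 0 0 0 p 0 0 0) (marked st.1) None st.2) 80
    (Conf (regs q 0 bs 0 0 0 0 p 0 0 0)
       (marked (unmark_visit st p).1) None (unmark_visit st p).2).
Proof.
move=> p_le; have w_gt0 : 0 < w by case: (w) space_le => //; lia.
eapply reach_le; first eapply reach_post.
- eapply reach_store; [done|done|done|fit|fit|fit|rewrite /=; lia|rewrite /=; lia].
- apply: reach_skip => k; rewrite /= /store_field /marked /= mem_filter.
  case: ifP => k_p.
    have -> : k = p by lia.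
    by rewrite subnn eqxx /=; case: ifP => //; lia.
  by case: ifP => // _; case: eqP => // kp; lia.
- by [].
Qed.

Lemma foldl_report_visit ps : exists ms,
  [/\ foldl report_visit ([::], [::]) ps = (ms, [seq nth x0 D p.-1 | p <- ms]),
      uniq ms & forall p, (p \in ms) = (p \in ps) && f (nth x0 D p.-1) y].
Proof.
elim/last_ind: ps => [|ps p [ms [foldE ms_uniq ms_in]]]; first by exists [::].
rewrite foldl_rcons foldE /report_visit /=; case: ifP => [/andP[fp p_in]|fp].
  exists (rcons ms p); split; first by rewrite map_rcons.
    by rewrite rcons_uniq p_in.
  move=> k; rewrite !mem_rcons !inE ms_in; case: eqP => [->|//].
  by rewrite fp.
exists ms; split=> // k; rewrite mem_rcons inE ms_in; case: eqP => [->|//].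
by move: fp; rewrite ms_in; case: (f _ y); case: (p \in ps).
Qed.

Lemma foldl_unmark_visit st ps :
  foldl unmark_visit st ps = ([seq k <- st.1 | k \notin ps], st.2).
Proof.
elim: ps st => [|p ps IH] [ms rep] /=; first by rewrite filter_predT.
rewrite IH /= -filter_predI; congr pair; apply: eq_filter => k /=.
by rewrite inE negb_or andbC.
Qed.

Lemma mem_found q p : (p \in found q) = (0 < p <= n) &&
  ((q %/ 2 ^ cm == alice_code lam rpub rpri (nth x0 D p.-1) y (advice_of_word pi q) (tree pi))
   && run lam (nth x0 D p.-1) y (advice_of_word pi q) rpub rpri (tree pi)).
Proof.
rewrite -accept_code /found; case: (bob_output _ _ _ _ _ _ _); last by rewrite !andbF.
case: (rest _ _ _ _ _ _ _ == 0); last by rewrite /= andbF.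
by rewrite /= mem_filter mem_rev mem_iota add1n ltnS andbC.
Qed.

Definition word_of (m : advice cm) : nat := bits_value cm (nth false m).

Lemma word_ofK m e : advice_of_word pi (word_of m + e * 2 ^ cm) = m.
Proof.
rewrite advice_of_word_high; apply/eq_from_tnth => i.
by rewrite tnth_mktuple odd_divn_exp_bits_value // (tnth_nth false).
Qed.

Lemma found_special p m : 0 < p <= n ->
  run lam (nth x0 D p.-1) y m rpub rpri (tree pi) -> p \in found_below (2 ^ (ca + cm)).
Proof.
move=> p_le run_m; pose a := alice_code lam rpub rpri (nth x0 D p.-1) y m (tree pi).
have a_lt : a < 2 ^ ca.
  by apply: leq_trans (alice_code_lt _ _ _ _ _ _ _) _; rewrite leq_exp2l.
have wd_lt : word_of m < 2 ^ cm by exact: bits_value_lt.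
(* The query code made of [m] and of the bits Alice really sends under it. *)
apply/flattenP; exists (found (word_of m + a * 2 ^ cm)).
  apply: map_f; rewrite mem_rev mem_iota /= add0n expnD.
  apply: leq_trans (_ : a.+1 * 2 ^ cm <= _); first by rewrite mulSn ltn_add2r.
  by rewrite leq_mul2r a_lt orbT.
rewrite mem_found p_le word_ofK run_m andbT divnDMl ?expn_gt0 //.
by rewrite divn_small // add0n eqxx.
Qed.

Lemma size_found q : size (found q) = count (fun x =>
  (q %/ 2 ^ cm == alice_code lam rpub rpri x y (advice_of_word pi q) (tree pi))
   && run lam x y (advice_of_word pi q) rpub rpri (tree pi)) D.
Proof.
set P := fun x => _; transitivity (count (fun p => P (nth x0 D p.-1)) (iota 1 n)).
  rewrite -size_filter; apply: perm_size; apply: uniq_perm.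
  - rewrite /found; case: ifP => // _.
    by rewrite filter_uniq // rev_uniq iota_uniq.
  - by rewrite filter_uniq // iota_uniq.
  - by move=> p; rewrite mem_found mem_filter mem_iota add1n ltnS andbC.
rewrite -[in RHS](mkseq_nth x0 D) /mkseq (iotaDl 1 0) !count_map.
exact: eq_count.
Qed.

Lemma advice_of_word_inj q q' :
  advice_of_word pi q = advice_of_word pi q' -> q = q' %[mod 2 ^ cm].
Proof.
have modE r : r %% 2 ^ cm = bits_value cm (nth false (advice_of_word pi r)).
  rewrite {2}(divn_eq r (2 ^ cm)) addnC advice_of_word_high.
  rewrite -[LHS](@bits_value_odd cm) ?ltn_pmod ?expn_gt0 //.
  by apply: eq_bigr => i _; rewrite -tnth_nth tnth_mktuple.
by rewrite !modE => ->.
Qed.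

(** For a fixed x, the part of a code beyond the advice must be Alice's code under that advice.
    Hence the codes that meet x inject into the advices on which the run accepts. *)
Lemma size_found_below :
  size (found_below (2 ^ (ca + cm))) <=
  \sum_(x <- D) \sum_(m : advice cm) run lam x y m rpub rpri (tree pi).
Proof.
pose P x (q : nat) :=
  (q %/ 2 ^ cm == alice_code lam rpub rpri x y (advice_of_word pi q) (tree pi))
   && run lam x y (advice_of_word pi q) rpub rpri (tree pi).
have -> : size (found_below (2 ^ (ca + cm))) =
    \sum_(q < 2 ^ (ca + cm)) \sum_(x <- D) P x q.
  elim: (2 ^ (ca + cm)) => [|q IH]; first by rewrite big_ord0.
  rewrite found_belowS size_cat IH big_ord_recr /= addnC; congr addn.
  rewrite size_found -sum1_count big_mkcond /=; apply: eq_bigr => x _.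
  by rewrite /P; case: (_ && _).
rewrite exchange_big /=; apply: leq_sum => x _.
have sumE (T : finType) (A : pred T) : \sum_(t : T) A t = #|[set t | A t]|.
  by rewrite -sum1dep_card [RHS]big_mkcond; apply: eq_bigr => t _; case: (A t).
rewrite (sumE _ (fun q : 'I_(2 ^ (ca + cm)) => P x q)) sumE.
rewrite -(card_in_imset (f := fun q : 'I_(2 ^ (ca + cm)) => advice_of_word pi q)).
  apply: subset_leq_card; apply/subsetP => _ /imsetP[q + ->].
  by rewrite !inE => /andP[].
move=> q q'; rewrite !inE => /andP[/eqP aq _] /andP[/eqP aq' _] eq_adv.
apply: val_inj; rewrite /= (divn_eq q (2 ^ cm)) (divn_eq q' (2 ^ cm)) aq aq' eq_adv.
by rewrite (advice_of_word_inj eq_adv).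
Qed.

Lemma queryP (tb : nat) :
  (forall m, bob_time y m (tree pi) <= tb) -> (forall j, j < N -> g0 j = false) -> uniq D ->
  (forall x, x \in D -> f x y -> exists m, run lam x y m rpub rpri (tree pi)) ->
  exists rep,
  reach query (Conf (regs 0 0 0 0 0 0 0 0 0 0 0) g0 None [::])
    (2 ^ (ca + cm) * (code_time tb).+1 + 150 * size (found_below (2 ^ (ca + cm))) + 10 +
     (2 ^ (ca + cm) * (code_time tb).+1 + 150 * size (found_below (2 ^ (ca + cm))) + 10))
    (Conf (regs 0 0 0 0 0 0 0 0 0 0 0) g0 None rep) /\
  perm_eq rep [seq x <- D | f x y].
Proof.
move=> bob_le g0_low D_uniq special_ex; set F := found_below _.
have [ms [foldE ms_uniq ms_in]] := foldl_report_visit F.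
have F_le p : p \in F -> 0 < p <= n.
  by case/flattenP => _ /mapP[q _ ->]; rewrite mem_found => /andP[].
have g0E : g0 =1 marked [::] by move=> j; rewrite /marked; case: ifP => // /g0_low.
exists [seq nth x0 D p.-1 | p <- ms]; split.
  apply: (reach_mem (g := marked [::])); last by move=> j; rewrite g0E.
  eapply reach_seq.
    exact: (reach_query_pass reach_report_new bob_le (st := ([::], [::]))).
  eapply reach_post; first exact: (reach_query_pass reach_unmark bob_le).
  rewrite foldl_unmark_visit -/F foldE /=.
  (* Every marked position was met in the first pass, so the second pass, over the same positions,
     clears it. *)
  have -> : [seq k <- ms | k \notin F] = [::].
    apply/eqP; rewrite -size_eq0 size_filter -leqn0 leqNgt -has_count.
    by apply/hasPn => p; rewrite ms_in negbK => /andP[].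
  by apply: reach_skip => j; rewrite g0E.
apply: uniq_perm.
- rewrite map_inj_in_uniq // => p p'; rewrite !ms_in => /andP[/F_le/andP[p0 pn] _].
  move=> /andP[/F_le/andP[p'0 p'n] _] /eqP; rewrite nth_uniq // ?prednK //.
  by move=> /eqP/(congr1 succn); rewrite !prednK.
- exact: filter_uniq.
- move=> x; rewrite mem_filter; apply/mapP/andP => [[p]|[fx x_in]].
    rewrite ms_in => /andP[/F_le/andP[p0 pn] fp] ->; split=> //.
    by rewrite mem_nth // prednK.
  have x_lt : index x D < n by rewrite index_mem.
  exists (index x D).+1; last by rewrite /= nth_index.
  rewrite ms_in /= nth_index // fx andbT.
  have [m run_m] := special_ex x x_in fx.
  by apply: (@found_special _ m) => //; rewrite /= nth_index.
Qed.

End Querying.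

(** * Expectations over finitely supported distributions *)

Section Expectation.
Variables (R : realFieldType) (T : choiceType).
Implicit Types (P : dist R T) (F G : T -> R) (c : R).

Lemma dist_ge0 P x : 0 <= P x.
Proof.
have [x_in|x_out] := boolP (x \in finsupp P); last by rewrite fsfun_dflt.
by case: P x_in => p /= /andP[/forallP p_ge0 _] x_in; exact: p_ge0 [` x_in]%fset.
Qed.

Lemma dist_sum1 P : \sum_(x <- finsupp P) P x = 1.
Proof. by case: P => p /= /andP[_ /eqP]. Qed.

Lemma ler_expect P F G : (forall x, F x <= G x) -> expect P F <= expect P G.
Proof. by move=> FG; apply: ler_sum => x _; apply: ler_wpM2l => //; exact: dist_ge0. Qed.

Lemma expect_const P c : expect P (fun=> c) = c.
Proof. by rewrite /expect -mulr_suml dist_sum1 mul1r. Qed.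

Lemma expectD P F G : expect P (fun x => F x + G x) = expect P F + expect P G.
Proof. by rewrite /expect -big_split; apply: eq_bigr => x _; rewrite mulrDr. Qed.

Lemma expectZ P c F : expect P (fun x => c * F x) = c * expect P F.
Proof. by rewrite /expect mulr_sumr; apply: eq_bigr => x _; rewrite mulrCA. Qed.

Lemma expect_sum P (I : Type) (r : seq I) (A : pred I) (F : I -> T -> R) :
  expect P (fun x => \sum_(i <- r | A i) F i x) = \sum_(i <- r | A i) expect P (F i).
Proof.
rewrite /expect exchange_big; apply: eq_bigr => x _ /=.
by rewrite mulr_sumr.
Qed.

Lemma prob_expect P (E : pred T) : prob P E = expect P (fun x => (E x)%:R).
Proof.
rewrite /prob /expect big_mkcond; apply: eq_bigr => x _.
by case: (E x); rewrite ?mulr1 ?mulr0.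
Qed.

Lemma finsupp_uniform (D : seq T) (uD : uniq D) (D_gt0 : (0 < size D)%N) :
  finsupp (uniform R uD D_gt0) =i D.
Proof.
move=> x; rewrite mem_finsupp /= fsfunE in_fset; case: ifP => xD; rewrite ?eqxx //.
by rewrite invr_eq0 pnatr_eq0 -lt0n D_gt0.
Qed.

(** Turns the average error under the uniform distribution into a sum over [D], whence the term eps
    * n. *)
Lemma expect_uniform (D : seq T) (uD : uniq D) (D_gt0 : (0 < size D)%N) F :
  (size D)%:R * expect (uniform R uD D_gt0) F = \sum_(x <- D) F x.
Proof.
have D_perm : perm_eq (finsupp (uniform R uD D_gt0)) D.
  by apply: uniq_perm => //; exact: finsupp_uniform.
rewrite /expect (perm_big _ D_perm) /= mulr_sumr; apply: eq_big_seq => x xD.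
rewrite fsfunE in_fset xD mulrA mulfV ?mul1r //.
by rewrite pnatr_eq0 -lt0n.
Qed.

End Expectation.

(** * Expected number of accepting pairs of element and advice *)

Section AcceptedRuns.
Variables (R : realFieldType) (X : choiceType) (Y : Type).
Variables (f : X -> Y -> bool) (pi : protocol R X Y) (eps delta : R).
Hypothesis delta_ge0 : 0 <= delta.
Hypothesis sound : has_soundness pi delta.
Hypothesis err : has_error f pi eps.

(** [eps] bounds the expectation of an indicator. The sign is needed to enlarge the coefficient of
    eps * n to [K]. *)
Lemma error_ge0 (lam : dist R X) (y : Y) : 0 <= eps.
Proof.
apply: le_trans (err lam y).
rewrite -(expect_const lam 0); apply: ler_expect => x.
rewrite -(expect_const (Ppub pi) 0); apply: ler_expect => rpub.
rewrite prob_expect -(expect_const (Ppri pi) 0).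
by apply: ler_expect => rpri; rewrite ler0n.
Qed.

(** The special advice depends on [rpub] but not on [rpri], so it is split off under the outer
    expectation, where soundness applies to each other advice. For the special one, acceptance is at
    most [f x y] plus the indicator of an error. *)
Lemma expect_accepts (lam : dist R X) (x : X) (y : Y) : x \in finsupp lam ->
  expect (Ppub pi) (fun rpub => expect (Ppri pi) (fun rpri =>
    \sum_(m : advice (advice_len pi)) (output lam x y m rpub rpri)%:R))
  <= (f x y)%:R + expect (Ppub pi) (fun rpub => prob (Ppri pi) (fun rpri =>
        output lam x y (special pi lam x y rpub) rpub rpri != f x y))
     + (2 ^ advice_len pi)%:R * delta.
Proof.
move=> x_in; rewrite -{1}(expect_const (Ppub pi) (f x y)%:R) -expectD.
rewrite -{1}(expect_const (Ppub pi) (_ * delta)) -expectD.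
apply: ler_expect => rpub; rewrite expect_sum (bigD1 (special pi lam x y rpub)) //=.
apply: lerD.
  rewrite prob_expect -{1}(expect_const (Ppri pi) (f x y)%:R) -expectD.
  apply: ler_expect => rpri; rewrite -natrD ler_nat.
  by case: (output _ _ _ _ _ _); case: (f x y).
apply: le_trans (_ : \sum_(m | m != special pi lam x y rpub) delta <= _).
  apply: ler_sum => m m_neq; apply: le_trans (sound x_in m_neq).
  rewrite prob_expect; apply: ler_expect => rpri.
  by case: (output _ _ _ _ _ _).
rewrite sumr_const -[delta *+ _]mulr_natl; apply: ler_wpM2r => //.
by rewrite ler_nat (leq_trans (max_card _)) // card_tuple card_bool.
Qed.

(** By linearity the elementwise bound is summed over [D]. The error is controlled only on average
    over [lam], which suffices since [lam] is uniform on [D]. *)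
Lemma expect_accepts_sum (D : seq X) (uD : uniq D) (D_gt0 : (0 < size D)%N) y
    (lam := uniform R uD D_gt0) :
  expect (Ppub pi) (fun rpub => expect (Ppri pi) (fun rpri =>
    (\sum_(x <- D) \sum_(m : advice (advice_len pi)) output lam x y m rpub rpri)%N%:R))
  <= (count (fun x => f x y) D)%:R + eps * (size D)%:R
     + (2 ^ advice_len pi)%:R * delta * (size D)%:R.
Proof.
have -> : expect (Ppub pi) (fun rpub => expect (Ppri pi) (fun rpri =>
    (\sum_(x <- D) \sum_(m : advice (advice_len pi)) output lam x y m rpub rpri)%N%:R))
  = \sum_(x <- D) expect (Ppub pi) (fun rpub => expect (Ppri pi) (fun rpri =>
    \sum_(m : advice (advice_len pi)) (output lam x y m rpub rpri)%:R)).
  rewrite -expect_sum; apply: eq_bigr => rpub _; congr (_ * _); rewrite -expect_sum.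
  apply: eq_bigr => rpri _; congr (_ * _); rewrite natr_sum; apply: eq_bigr => x _.
  by rewrite natr_sum.
apply: le_trans (_ : \sum_(x <- D) ((f x y)%:R +
    expect (Ppub pi) (fun rpub => prob (Ppri pi) (fun rpri =>
      output lam x y (special pi lam x y rpub) rpub rpri != f x y))
    + (2 ^ advice_len pi)%:R * delta) <= _).
  rewrite big_seq [leRHS]big_seq; apply: ler_sum => x x_in.
  by apply: expect_accepts; rewrite finsupp_uniform.
rewrite !big_split /= big_const_seq count_predT iter_addr_0 -[_ *+ _]mulr_natr.
rewrite lerD2r lerD //.
  by rewrite -sum1_count natr_sum [leRHS]big_mkcond; apply: ler_sum => x _; case: (f x y).
rewrite -expect_uniform mulrC; apply: ler_wpM2r; first exact: ler0n.
exact: err.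
Qed.

End AcceptedRuns.

(** * Numerical bounds for space and time *)

Section Bounds.
Local Open Scope nat_scope.

(** Bob's output takes at least one step; therefore [tb] is positive and additive constants can be
    absorbed into products with the times. *)
Lemma bob_time_gt0 (R : realFieldType) (X : choiceType) (Y : Type)
    (Rpub Rpri : choiceType) (cm : nat) (y : Y) m (t : ptree R X Y Rpub Rpri cm) :
  0 < bob_time y m t.
Proof.
by elim: t => [o st|msg st t0 IH0 t1 IH1|msg st t0 IH0 t1 IH1|msg st t0 IH0 t1 IH1] //=;
  rewrite leq_max IH0.
Qed.

Lemma agree_start (R : realFieldType) (X : choiceType) (Y : Type)
    (pi : protocol R X Y) n ca cb cc cm (g g' : nat -> bool) : g =1 g' ->
  agree (start_state pi [:: n; ca; cb; cc; cm] g)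
    (Conf [:: n; ca; cb; cc; cm; 0; 0; 0; 0; 0; 0; 0; 0; 0; 0; 0] g' None [::]).
Proof. by move=> eq_g; split=> //= i; do 16![case: i => [|i] //]. Qed.

Lemma pow_code_le K ca cb cm : 2 <= K ->
  2 ^ (ca + cb + cm) * 2 ^ (ca + cb + cm) <= 2 ^ (K * (ca + cb + cm)).
Proof. by move=> K_ge; rewrite -expnD leq_exp2l // addnn -mul2n leq_mul2r K_ge orbT. Qed.

Lemma space_bound K n ca cb cc cm : 1000 <= K -> 0 < n ->
  n + 2 + 2 ^ (ca + cb + cm) * ((n + 2) * 2 + cc) <=
  K * 2 ^ (K * (ca + cb + cm)) * (n + cc).
Proof.
move=> K_ge n_gt0; set x := ca + cb + cm.
have le_P : 2 ^ x <= 2 ^ (K * x) by rewrite leq_exp2l // leq_pmull //; lia.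
(* From n >= 1: n + 2 <= 3 n and 2 (n + 2) <= 6 n, which add up to 9. *)
apply: leq_trans (_ : 9 * (2 ^ x * (n + cc)) <= _).
  by have := expn_gt0 2 x; move: (2 ^ x) => P; nia.
by rewrite mulnA leq_mul2r leq_mul ?orbT //; lia.
Qed.

(** One factor 2 ^ x counts the codes; a second one absorbs the summands ca, cb and cm of the time
    per element, by x < 2 ^ x. The exponent K * x pays for both. *)
Lemma preprocess_bound K n ca cb cm ta tb tc
    (element := 100 * (5 + ca + cb + tc) + ta + cm) : 1000 <= K -> 0 < n -> 0 < tb ->
  2 ^ (ca + cb + cm) * (n * element.+1 + 150).+1 + 20 <=
  K * 2 ^ (K * (ca + cb + cm)) * n * (ta + tb + tc).
Proof.
move=> K_ge n_gt0 tb_gt0; set x := ca + cb + cm.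
have x_lt : x < 2 ^ x by exact: ltn_expl.
have le_P : 2 ^ x * 2 ^ x <= 2 ^ (K * x) by apply: pow_code_le; lia.
set Z := ta + tb + tc; set P := 2 ^ x in x_lt le_P *.
have elt : element.+1 <= 601 * (P * Z).
  apply: leq_trans (_ : 601 * ((x + 1) * Z) <= _).
    by rewrite /element /Z /x; nia.
  by rewrite leq_mul2l leq_mul2r; lia.
apply: leq_trans (_ : 1000 * (P * P) * n * Z <= _); last first.
  by rewrite !leq_mul2r leq_mul ?orbT.
have P_gt0 : 0 < P by lia.
have Z_gt0 : 0 < Z by rewrite /Z; lia.
apply: leq_trans (_ : P * (n * (601 * (P * Z)) + 150).+1 + 20 <= _).
  by rewrite leq_add2r leq_mul2l ltnS leq_add2r leq_mul2l elt !orbT.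
have h1 : P <= P * P * n * Z by rewrite -!mulnA leq_pmulr // !muln_gt0 P_gt0 n_gt0.
by lia.
Qed.

(** The factor 2 stands for the two passes. Here ca, cb, cm appear in the bound itself, so a single
    power of two is enough. *)
Lemma query_bound K ca cb cc cm tb
    (code := 100 * (4 + ca + cb + cc) + tb + cm) : 2000 <= K -> 0 < tb ->
  2 * (2 ^ (ca + cm) * code.+1 + 10) <=
  K * 2 ^ (K * (ca + cm)) * (ca + cb + cm + cc + tb).
Proof.
move=> K_ge tb_gt0; set Z := ca + cb + cm + cc + tb.
have le_P : 2 ^ (ca + cm) <= 2 ^ (K * (ca + cm)) by rewrite leq_exp2l // leq_pmull //; lia.
have codeZ : code.+1 <= 502 * Z by rewrite /code /Z; lia.
apply: leq_trans (_ : 2000 * 2 ^ (ca + cm) * Z <= _); last first.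
  by rewrite leq_mul2r leq_mul ?orbT.
have := expn_gt0 2 (ca + cm); move: (2 ^ (ca + cm)) => P /= P_gt0.
apply: leq_trans (_ : 2 * (P * (502 * Z) + 10) <= _).
  by rewrite leq_mul2l leq_add2r leq_mul2l codeZ orbT.
have : 0 < P * Z by rewrite muln_gt0 P_gt0 /Z; lia.
by lia.
Qed.

End Bounds.

(** * The data structure *)

Theorem theorem4p1 :
  exists (K : nat) (preprocess query : prog),
  forall (R : realFieldType) (X : choiceType) (Y : Type) (y0 : Y)
         (f : X -> Y -> bool) (pi : protocol R X Y) (eps delta : R)
         (ca cb cc cm ta tb tc : nat),
  0 <= delta ->
  has_soundness pi delta ->
  has_error f pi eps ->
  false_positive_error f pi ->
  has_cost pi ca cb cc cm ->
  has_time pi ta tb tc ->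
  forall (D : seq X) (uD : uniq D) (D_gt0 : (0 < size D)%N) (w : nat),
  let n := size D in
  let lam := uniform R uD D_gt0 in
  let args := [:: n; ca; cb; cc; cm] in
  let s := (K * 2 ^ (K * (ca + cb + cm)) * (n + cc))%N in
  (s <= 2 ^ w)%N ->
  exists built : Rpub pi -> Rpri pi -> state pi,
    (forall (rpub : Rpub pi) (rpri : Rpri pi),
       exists tp : nat,
         exec f D lam w s (Preprocess rpub rpri) preprocess
           (start_state pi args (fun=> false)) tp (built rpub rpri) /\
         (tp <= K * 2 ^ (K * (ca + cb + cm)) * n * (ta + tb + tc))%N) /\
    (forall y : Y,
       exists tq : Rpub pi -> Rpri pi -> nat,
         (forall (rpub : Rpub pi) (rpri : Rpri pi),
            exists final : state pi,
              [/\ exec f D lam w s (Query pi y) query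
                    (start_state pi args (memory (built rpub rpri)))
                    (tq rpub rpri) final,
                  memory final =1 memory (built rpub rpri)
                & perm_eq (reported final) [seq x <- D | f x y]]) /\
         expect (Ppub pi) (fun rpub =>
           expect (Ppri pi) (fun rpri => (tq rpub rpri)%:R))
         <= (K * 2 ^ (K * (ca + cm)) * (ca + cb + cm + cc + tb))%N%:R
            + K%:R * eps * n%:R
            + (K * 2 ^ (K * cm))%N%:R * delta * n%:R
            + K%:R * (count (fun x => f x y) D)%:R).
Proof.
(* 2000 is the largest lower bound on [K] asked by the estimates; only this inequality is used. *)
have [K K_ge] : exists K, (2000 <= K)%N by exists 2000%N.
exists K, preprocess, query.
move=> R X Y y0 f pi eps delta ca cb cc cm ta tb tc delta_ge0 sound err fpe.
move=> [ca_le cb_le cc_le <-] [ta_le tb_le tc_le] D uD D_gt0 w n lam args s s_le.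
have [x0 x0_in] : exists x, x \in D.
  by case: (D) (D_gt0) => // x D' _; exists x; rewrite mem_head.
have tb_gt0 : (0 < tb)%N.
  (* [y0] provides a query on which Bob spends time, so that [tb] is positive already for
     preprocessing. *)
  exact: leq_trans (bob_time_gt0 y0 [tuple of nseq _ false] _) (tb_le _ _).
have K_ge1 : (1000 <= K)%N by lia.
have space_ge := space_bound ca cb cc (advice_len pi) K_ge1 D_gt0.
have suppD : finsupp lam =i D := finsupp_uniform R uD D_gt0.
(* The final state is known to exist for each pair of random strings; choice makes it a function of
   them. *)
have /functional_choice[built builtP] : forall r : Rpub pi * Rpri pi,
  exists st : state pi, exists g,
  [/\ exists tp, exec f D lam w s (Preprocess r.1 r.2) preprocess
        (start_state pi args (fun=> false)) tp st /\
        (tp <= K * 2 ^ (K * (ca + cb + advice_len pi)) * n * (ta + tb + tc))%N,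
      memory st =1 g, forall j, (j < n + 2)%N -> g j = false
    & forall c, (c < 2 ^ (ca + cb + advice_len pi))%N ->
        good_record D lam ca cc r.1 r.2 x0 g c].
  move=> [rpub rpri].
  have alice_le x m : x \in D -> (alice_time lam x m (tree pi) <= ta)%N.
    by rewrite -suppD; exact: ta_le.
  have [g [re low good]] := preprocessP f space_ge s_le x0 D_gt0 ca_le cb_le cc_le
    alice_le (tc_le lam rpub rpri).
  have [tp [st [ex tp_le st_g]]] := re _ (agree_start _ _ _ _ _ _ (fun=> erefl)).
  exists st, g; split=> //; last exact: agree_mem st_g.
  exists tp; split=> //; apply: leq_trans tp_le _.
  exact: preprocess_bound.
exists (fun rpub rpri => built (rpub, rpri)); split.
  by move=> rpub rpri; have [g []] := builtP (rpub, rpri).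
move=> y.
pose accepts rpub rpri :=
  (\sum_(x <- D) \sum_(m : advice (advice_len pi)) output lam x y m rpub rpri)%N.
pose base := (K * 2 ^ (K * (ca + advice_len pi)) * (ca + cb + advice_len pi + cc + tb))%N.
(* Choice again, so that the expectation of the query time can be formed. Each position met costs at
   most 150 in each of the two passes, whence 300. *)
have /functional_choice[tq tqP] : forall r : Rpub pi * Rpri pi, exists t : nat,
  (exists final : state pi,
     [/\ exec f D lam w s (Query pi y) query (start_state pi args (memory (built r))) t final,
         memory final =1 memory (built r)
       & perm_eq (reported final) [seq x <- D | f x y]]) /\
  (t <= base + 300 * accepts r.1 r.2)%N.
  move=> r; have [g [_ mem_g low good]] := builtP r.
  have special_ex x : x \in D -> f x y ->
      (* If the special advice were rejected although [f x y] holds, this would be an error, and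
         type I error would force [f x y = false]. *)
      exists m, run lam x y m r.1 r.2 (tree pi).
    move=> xD fxy; exists (special pi lam x y r.1); apply: contraT => /negbTE out0.
    have := fpe lam y x r.1 r.2; rewrite suppD /output out0 fxy => /(_ xD isT) //.
  have [rep [re rep_perm]] := queryP space_ge s_le ca_le cb_le cc_le good (tb_le y) low uD
    special_ex.
  have [t [final [ex t_le fin]]] := re _ (agree_start _ _ _ _ _ _ mem_g).
  exists t; split.
    exists final; split=> //; first by move=> j; rewrite (agree_mem fin) mem_g.
    by rewrite (agree_rep fin).
  apply: leq_trans t_le _.
  have := size_found_below D lam ca r.1 r.2 y x0.
  have := query_bound ca cb cc (advice_len pi) K_ge tb_gt0.
  rewrite /base /accepts /output /code_time.
  move: (size _) (\sum_(x <- D) _)%N (K * _ * _)%N (2 ^ _ * _)%N => F A B C.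
  by lia.
exists (fun rpub rpri => tq (rpub, rpri)); split.
  by move=> rpub rpri; have [] := tqP (rpub, rpri).
have := expect_accepts_sum delta_ge0 sound err uD D_gt0 y; rewrite -/lam -/n => acc_le.
have eps_ge0 : 0 <= eps := error_ge0 err lam y.
apply: le_trans (_ : base%:R + 300 * ((count (fun x => f x y) D)%:R + eps * n%:R
   + (2 ^ advice_len pi)%:R * delta * n%:R) <= _).
  apply: le_trans (_ : base%:R + 300 * expect (Ppub pi) (fun rpub =>
      expect (Ppri pi) (fun rpri => (accepts rpub rpri)%:R)) <= _); last first.
    by rewrite lerD2l ler_wpM2l // ler0n.
  rewrite -(expect_const (Ppub pi) base%:R) -expectZ -expectD; apply: ler_expect => rpub.
  rewrite -(expect_const (Ppri pi) base%:R) -expectZ -expectD; apply: ler_expect => rpri.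
  by rewrite -natrM -natrD ler_nat; have [] := tqP (rpub, rpri).
have pow_le : (300 * 2 ^ advice_len pi <= K * 2 ^ (K * advice_len pi))%N.
  by rewrite leq_mul ?leq_exp2l ?leq_pmull //; lia.
have K300 : 300 <= K%:R :> R by rewrite ler_nat; lia.
have h1 : 300 * (count (fun x => f x y) D)%:R <= K%:R * (count (fun x => f x y) D)%:R :> R.
  by rewrite ler_wpM2r // ler0n.
have h2 : 300 * (eps * n%:R) <= K%:R * (eps * n%:R).
  by rewrite ler_wpM2r // mulr_ge0 // ler0n.
have h3 : (300 * 2 ^ advice_len pi)%N%:R * (delta * n%:R) <=
    (K * 2 ^ (K * advice_len pi))%N%:R * (delta * n%:R).
  by rewrite ler_wpM2r ?ler_nat // mulr_ge0 // ler0n.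
rewrite natrM in h3; rewrite -/base; move: h1 h2 h3.
lra.
Qed.
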